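(* Let $N > m\geq 1$ be integers, let $\beta > 0$, and let $A:\mathbb{R}^N\to\mathbb{R}^m$ be a fixed non-zero linear map with spectrum $\mathrm{Sp}(AA^* )\subset[\beta^2,\infty)$. Then for any rational $\epsilon_1\in(0,3/16]$ and any integer $\ell>m+2$ there exists a domain $\Omega\subset T_\ell(A)$ of training sets, with corresponding initial domains $\{\mathcal{M}_1(\mathcal{T}):\mathcal{T}\in\Omega\}$, such that $\Xi(\mathcal{T})\neq\emptyset$ for every $\mathcal{T}\in\Omega$ and all of the following hold simultaneously. (i) No algorithm, not even randomised, can approximate an optimal neural network to accuracy $\epsilon_1$ for all $\mathcal{T}\in\Omega$ (with probability greater than $p>1/2$ in the randomised case, even if the algorithm is allowed a non-zero probability of not halting). That is: there is no general algorithm $\Gamma$ on $\tilde\Omega$ such that, for every $\mathcal{T}\in\Omega$ and every $\tilde{\mathcal{T}}\in\tilde\Omega$ corresponding to $\mathcal{T}$, $\Gamma(\tilde{\mathcal{T}})$ approximates an optimal neural network in $\Xi(\mathcal{T})$ to accuracy $\epsilon_1$; and for no $p>1/2$ is there a randomised general algorithm $\Gamma^{\mathrm{ran}}$ on $\tilde\Omega$ such that, for every $\mathcal{T}\in\Omega$ and every $\tilde{\mathcal{T}}$ corresponding to $\mathcal{T}$, $\Gamma^{\mathrm{ran}}_{\tilde{\mathcal{T}}}$ approximates an optimal neural network in $\Xi(\mathcal{T})$ to accuracy $\epsilon_1$ with $\mathbb{P}_{\tilde{\mathcal{T}}}$-probability greater than $p$. (ii) There exists an algorithm (Turing machine with oracle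 access to its input) $\Gamma$ such that for all $\mathcal{T}\in\Omega$, all $\tilde{\mathcal{T}}\in\tilde\Omega$ corresponding to $\mathcal{T}$ and all dyadic $\epsilon>2\epsilon_1$, $\mathbf{N}_{\tilde{\mathcal{T}},\epsilon}=\Gamma(\tilde{\mathcal{T}},\epsilon)$ is a neural network that approximates an optimal neural network in $\Xi(\mathcal{T})$ to accuracy $\epsilon$, and whose Lipschitz constant satisfies $L(\mathbf{N}_{\tilde{\mathcal{T}},\epsilon})\leq 2/\beta$. (iii) There exist $\mathcal{T}_1\in\Omega$ and $D>0$ such that $\Xi_D(\mathcal{T}_1)\neq\emptyset$, i.e. there is an optimal neural network for $\mathcal{T}_1$ with Lipschitz constant at most $D$. Yet there is a $\tilde{\mathcal{T}}_1\in\tilde\Omega$ corresponding to $\mathcal{T}_1$ such that for any $K>0$, any $\delta\in(0,\epsilon_1)$, any $\epsilon\in(\epsilon_1,2\epsilon_1-\delta]$ and any general algorithm $\hat\Gamma$ for which $\mathbf{N}_{\tilde{\mathcal{T}},\epsilon}=\hat\Gamma(\tilde{\mathcal{T}},\epsilon)$ is a neural network approximating an optimal neural network in $\Xi(\mathcal{T})$ to accuracy $\epsilon$ for all $\mathcal{T}\in\Omega$ and all $\tilde{\mathcal{T}}$ corresponding to $\mathcal{T}$, the following holds: $0\in\pi_2(\mathcal{T}_1)$, and for every $\eta>0$ there exists $y\neq 0$ with $\|y\|_2\leq\eta$ and $$\frac{\|\mathbf{N}_{\tilde{\mathcal{T}}_1,\epsilon}(0)-\mathbf{N}_{\tilde{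\mathcal{T}}_1,\epsilon}(y)\|_2}{\|y\|_2}>K.$$
   Context: Training sets. $T_\ell(A)$ is the set of ordered tuples $\mathcal{T}=((x^k,y^k))_{k=1}^\ell\in(\mathbb{R}^N\times\mathbb{R}^m)^\ell$ with $\|x^k\|_2\leq1$, $\|y^k\|_2\leq 1$, $y^k=Ax^k$, and pairwise distinct entries. Write $(x,y)\in\mathcal{T}$ if $(x,y)$ is one of the entries. Put $\mathcal{M}_1(\mathcal{T})=\{x:(x,y)\in\mathcal{T}\}$, $\mathcal{M}_2(\mathcal{T})=A(\mathcal{M}_1(\mathcal{T}))$, $\pi_2(\mathcal{T})=(y^1,\dots,y^\ell)$ (and $y\in\pi_2(\mathcal{T})$ means $y=y^k$ for some $k$). For $\Omega\subset T_\ell(A)$ let $\mathcal{F}=\{(A,\mathcal{M}_1(\mathcal{T})):\mathcal{T}\in\Omega\}$ and $\bigcup_{\mathcal{F}}\mathcal{M}_2=\bigcup_{\mathcal{T}\in\Omega}A(\mathcal{M}_1(\mathcal{T}))$. Neural networks. A neural network $\mathbf{N}:\mathbb{R}^m\to\mathbb{R}^N$ is a map $\mathbf{N}(y^0)=V^L(y^0,\dots,y^{L-1})$, where $y^i=\rho_i(V^i(y^0,\dots,y^{i-1}))$ for $i=1,\dots,L-1$, each $V^j:\mathbb{R}^{N_0}\times\dots\times\mathbb{R}^{N_{j-1}}\to\mathbb{R}^{N_j}$ is affine ($N_0=m$, $N_L=N$; $L$ and the other $N_j$ arbitrary), and each $\rho_i:\mathbb{R}\to\mathbb{R}$ is applied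 componentwise and belongs to a fixed finite set $\mathcal{A}$ of permitted activation functions. All functions in $\mathcal{A}$ are computable, $\mathcal{A}$ contains $t\mapsto t^2$, and $\mathcal{A}$ contains a function $f$ with $f(t)=1/(1+t)$ for all $t\geq0$; the results hold for any such $\mathcal{A}$. $\mathcal{NN}_{m,N}^{\mathcal{F}}$ is the set of neural networks $\mathbb{R}^m\to\mathbb{R}^N$ that are bounded on $\bigcup_{\mathcal{F}}\mathcal{M}_2$, with metric $d(\mathbf{N}_1,\mathbf{N}_2)=\sup_{z\in\bigcup_{\mathcal{F}}\mathcal{M}_2}\|\mathbf{N}_1(z)-\mathbf{N}_2(z)\|_2$ (for the purpose of the metric, networks equal on $\bigcup_{\mathcal F}\mathcal{M}_2$ are identified). $L(\mathbf{N})=\sup_{y\neq\hat y}\|\mathbf{N}(y)-\mathbf{N}(\hat y)\|_2/\|y-\hat y\|_2$ is the Lipschitz constant. Optimality. For $\mathcal{M}_1\subset\mathbb{R}^N$, $\mathcal{M}_2=A(\mathcal{M}_1)$, let $c_{\mathrm{opt}}(A,\mathcal{M}_1)=\inf_{\varphi}\sup_{x\in\mathcal{M}_1}d_1^H(\varphi(Ax),x)$, the infimum over all multivalued maps $\varphi:\mathcal{M}_2\rightrightarrows\mathbb{R}^N$ with non-empty values, where $d_1^H(M,x)=\sup_{\tilde x\in M}\|\tilde x-x\|_2$ (so it is $\|\varphi(Ax)-x\|_2$ for single-valued $\varphi$). A map $\varphi$ is optimal for $(A,\mathcal{M}_1)$ if $\sup_{x\in\mathcal{M}_1}d_1^H(\varphi(Ax),x)\leq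 c_{\mathrm{opt}}(A,\mathcal{M}_1)$. $\Xi:\Omega\rightrightarrows\mathcal{NN}_{m,N}^{\mathcal{F}}$ is the multivalued map sending $\mathcal{T}$ to the set of all networks in $\mathcal{NN}_{m,N}^{\mathcal{F}}$ that are optimal for $(A,\mathcal{M}_1(\mathcal{T}))$, and $\Xi_D(\mathcal{T})=\{\mathbf{N}\in\Xi(\mathcal{T}):L(\mathbf{N})\leq D\}$. A network $\mathbf{N}'$ approximates an optimal neural network in $\Xi(\mathcal{T})$ to accuracy $\epsilon$ if $\inf_{\mathbf{N}\in\Xi(\mathcal{T})}d(\mathbf{N}',\mathbf{N})\leq\epsilon$; a non-halting output has error $\infty$. Inexact input. $\tilde{\mathcal{T}}=(\{(\tilde x^k(n),\tilde y^k(n))\}_{n=1}^\infty)_{k=1}^\ell$, with all vector components dyadic rationals, corresponds to $\mathcal{T}=((x^k,y^k))_{k=1}^\ell$ if $\|\tilde x^k(n)-x^k\|_2\leq2^{-n}$ and $\|\tilde y^k(n)-y^k\|_2\leq2^{-n}$ for all $k,n$. $\tilde\Omega$ is the set of all $\tilde{\mathcal{T}}$ corresponding to some $\mathcal{T}\in\Omega$. Let $\tilde\Lambda$ be the countable set of all read-out functions on $\tilde\Omega$ returning one coordinate of one $\tilde x^k(n)$ or $\tilde y^k(n)$. General algorithms (used for negative statements). A general algorithm on $\tilde\Omega$ is a map $\Gamma:\tilde\Omega\to\mathcal{NN}_{m,N}^{\mathcal{F}}\cup\{\mathrm{NH}\}$ (NH = ''not halting'') together with sets $\Lambda_\Gamma(\iota)\subseteq\tilde\Lambda$,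 $\iota\in\tilde\Omega$, such that: $\Lambda_\Gamma(\iota)$ is finite whenever $\Gamma(\iota)\neq\mathrm{NH}$; $\Gamma(\iota)$ is uniquely determined by $\{f(\iota)\}_{f\in\Lambda_\Gamma(\iota)}$; and if $f(\iota')=f(\iota)$ for all $f\in\Lambda_\Gamma(\iota)$ then $\Lambda_\Gamma(\iota')=\Lambda_\Gamma(\iota)$. If there is an additional accuracy argument $\epsilon$, this is required of $\Gamma(\cdot,\epsilon)$ for each fixed $\epsilon$. A randomised general algorithm $\Gamma^{\mathrm{ran}}$ on $\tilde\Omega$ is a collection $X$ of general algorithms, a $\sigma$-algebra $\mathcal{E}$ on $X$ and probability measures $\{\mathbb{P}_\iota\}_{\iota\in\tilde\Omega}$ on $\mathcal{E}$ such that: (1) for each $\iota$ the map $\Gamma^{\mathrm{ran}}_\iota:X\ni\Gamma\mapsto\Gamma(\iota)$ is measurable, the target carrying the $\sigma$-algebra of sets $T$ and $T\cup\{\mathrm{NH}\}$ with $T$ Borel; (2) enumerating $\tilde\Lambda=\{f_1,f_2,\dots\}$, $\{\Gamma\in X:\sup\{r:f_r\in\Lambda_\Gamma(\iota)\}\leq n\}\in\mathcal{E}$ for all $n,\iota$; (3) if $E\in\mathcal{E}$ and $f(\iota_1)=f(\iota_2)$ for all $\Gamma\in E$ and $f\in\Lambda_\Gamma(\iota_1)$, then $\mathbb{P}_{\iota_1}(E)=\mathbb{P}_{\iota_2}(E)$. Turing algorithms (used for positive statements). A Turing machine accesses $\tilde{\mathcal{T}}$ through an oracle returning the binary strings of the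 requested dyadic coordinates; it outputs a finite string encoding a neural network (rational entries, or codes for computable entries, of the affine maps, and codes for the activation functions). *)

(* Defs.v *)
From Corelib Require Import BinNums.
From HB Require Import structures.
From mathcomp Require Import all_boot all_order all_algebra.
From mathcomp Require Import all_classical all_reals all_analysis.
Set Implicit Arguments.
Unset Strict Implicit.
Unset Printing Implicit Defensive.
Import Order.TTheory GRing.Theory Num.Theory.
Local Open Scope classical_set_scope.
Local Open Scope ring_scope.

(** * Strings and their codes *)

(* Tape symbols are natural numbers; each machine below mentions only finitely
   many of them. *)
Notation word := (seq nat).
Definition blank : nat := 0.
Definition digit (b : bool) : nat := if b then 2 else 1.
Definition separator : nat := 3.

Fixpoint pos_digits (p : positive) : word :=
  match p with
  | xH => [:: digit true]
  | xO p' => rcons (pos_digits p') (digit false)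
  | xI p' => rcons (pos_digits p') (digit true)
  end.

(* Most significant digit first; 0 is the empty numeral. *)
Definition binary (n : nat) : word :=
  if bin_of_nat n is Npos p then pos_digits p else [::].

Definition write_nats (s : seq nat) : word :=
  flatten [seq rcons (binary n) separator | n <- s].

Fixpoint read_nats_from (acc : nat) (w : word) : seq nat :=
  match w with
  | [::] => [::]
  | a :: w' => if a == separator then acc :: read_nats_from 0 w'
               else read_nats_from (acc.*2 + (a == digit true)) w'
  end.
Definition read_nats (w : word) : seq nat := read_nats_from 0 w.

Lemma read_pos_digits (p : positive) (w : word) :
  read_nats_from 0 (pos_digits p ++ w) = read_nats_from (nat_of_pos p) w.
Proof.
elim: p w => [p IH|p IH|] w //=; rewrite ?cat_rcons ?IH /=.
  by rewrite addn1 natTrecE.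
by rewrite addn0 natTrecE.
Qed.

Lemma write_natsK : cancel write_nats read_nats.
Proof.
elim=> [|n s IH] //; rewrite /write_nats /= cat_rcons -/(write_nats s) /read_nats.
have -> : read_nats_from 0 (binary n ++ separator :: write_nats s) =
          read_nats_from n (separator :: write_nats s).
  by rewrite -{2}(bin_of_natK n) /binary; case: (bin_of_nat n) => [|p] //=;
     rewrite read_pos_digits.
by rewrite /= -[in RHS]IH.
Qed.

Definition ser_int (z : int) : seq nat := [:: ((z < 0)%R : nat); `|z|%N].
Definition ser_rat (q : rat) : seq nat := ser_int (numq q) ++ [:: `|denq q|%N].
Definition rat_word (q : rat) : word := write_nats (ser_rat q).

(** * Oracle Turing machines *)

Inductive direction := MoveLeft | Stay | MoveRight.

(* A two-way infinite tape: [left_cells] is listed from the head outwards, and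
   all cells that are not listed are blank. *)
Record tape := Tape { left_cells : word; head_cell : nat; right_cells : word }.

Definition tape_of (w : word) : tape := Tape [::] (head blank w) (behead w).

(* The word starting under the head and ending before the first blank. *)
Definition tape_word (t : tape) : word :=
  let s := head_cell t :: right_cells t in take (index blank s) s.

Definition write_move (a : nat) (d : direction) (t : tape) : tape :=
  let: Tape l _ r := t in
  match d with
  | MoveLeft => Tape (behead l) (head blank l) (a :: r)
  | Stay => Tape l a r
  | MoveRight => Tape (a :: l) (head blank r) (behead r)
  end.

Record instruction := Instruction {
  in_state : nat; in_work : nat; in_oracle : nat;
  out_state : nat;
  out_work : nat; move_work : direction;
  out_oracle : nat; move_oracle : direction }.

(* A machine has a work tape and an oracle tape, and is given by its finite
   instruction table; the first applicable instruction is executed, and the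
   machine halts when there is none.  In the state [query_state] the word on
   the oracle tape is replaced by the answer of the oracle to it. *)
Definition machine := seq instruction.
Definition start_state : nat := 0.
Definition query_state : nat := 1.
Definition answer_state : nat := 2.

Record config := Config { state : nat; work : tape; oracle : tape }.

Definition applicable (c : config) (i : instruction) : bool :=
  [&& in_state i == state c, in_work i == head_cell (work c)
    & in_oracle i == head_cell (oracle c)].

Definition execute (c : config) (i : instruction) : config :=
  Config (out_state i) (write_move (out_work i) (move_work i) (work c))
         (write_move (out_oracle i) (move_oracle i) (oracle c)).

Definition step (O : word -> word) (M : machine) (c : config) : option config :=
  if state c == query_state
  then Some (Config answer_state (work c) (tape_of (O (tape_word (oracle c)))))
  else omap (execute c) (ohead [seq i <- M | applicable c i]).

Definition initial (w : word) : config :=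
  Config start_state (tape_of w) (tape_of [::]).

Definition halts_with (O : word -> word) (M : machine) (w v : word) : Prop :=
  exists (n : nat) (c : config),
    [/\ iter n (obind (step O M)) (Some (initial w)) = Some c,
        step O M c = None & tape_word (work c) = v].

(* Queries are finite sequences of natural numbers; a query on which [g] is
   undefined is answered by the empty word. *)
Definition oracle_of (g : seq nat -> option rat) : word -> word :=
  fun w => if g (read_nats w) is Some q then rat_word q else [::].

Definition no_oracle : word -> word := fun=> [::].

Definition ser_direction (d : direction) : nat :=
  match d with MoveLeft => 0 | Stay => 1 | MoveRight => 2 end.

Definition ser_instruction (i : instruction) : seq nat :=
  [:: in_state i; in_work i; in_oracle i; out_state i;
      out_work i; ser_direction (move_work i);
      out_oracle i; ser_direction (move_oracle i)].

Definition ser_machine (M : machine) : seq nat :=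
  size M :: flatten [seq ser_instruction i | i <- M].

Definition is_dyadic (q : rat) : Prop :=
  exists (z : int) (n : nat), q = z%:~R / 2 ^+ n.

Definition computable_function (R : realType) (f : R -> R) : Prop :=
  exists M : machine,
  forall (t : R) (phi : nat -> rat),
    (forall n, is_dyadic (phi n) /\ `|ratr (phi n) - t| <= 2 ^- n) ->
  forall n : nat, exists q : rat,
    halts_with (oracle_of (fun s => if s is [:: k] then Some (phi k) else None))
      M (write_nats [:: n]) (rat_word q) /\
    `|ratr q - f t| <= 2 ^- n.

(** * Neural networks *)

(* [network E K N p] are networks with coefficients in [E], with output in
   dimension [N] and with activation functions indexed by 'I_K.  The product
   of the spaces of the layers computed so far is identified, by stacking,
   with the space of column vectors of size [p]; so a hidden layer consists of
   an affine map from dimension [p] to some dimension [n] and of an activation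
   function, and is followed by a network on the stacked dimension [p + n].
   Networks from dimension [m] start at [p := m]. *)
Inductive network (E : Type) (K N : nat) : nat -> Type :=
| OutputLayer p of 'M[E]_(N, p) & 'cV[E]_N : network E K N p
| HiddenLayer p n of 'M[E]_(n, p) & 'cV[E]_n & 'I_K & network E K N (p + n) :
    network E K N p.

Fixpoint realize (R : realType) (K N : nat) (act : 'I_K -> R -> R) (p : nat)
    (net : network R K N p) : 'cV[R]_p -> 'cV[R]_N :=
  match net in network _ _ _ p return 'cV[R]_p -> 'cV[R]_N with
  | OutputLayer p W b => fun y => W *m y + b
  | HiddenLayer p n W b a net' => fun y =>
      realize act net' (col_mx y (map_mx (act a) (W *m y + b)))
  end.

Fixpoint map_network (E E' : Type) (K N : nat) (f : E -> E') (p : nat)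
    (net : network E K N p) : network E' K N p :=
  match net in network _ _ _ p return network E' K N p with
  | OutputLayer p W b => OutputLayer K (map_mx f W) (map_mx f b)
  | HiddenLayer p n W b a net' =>
      HiddenLayer (map_mx f W) (map_mx f b) a (map_network f net')
  end.

Fixpoint all_coefs (E : Type) (K N : nat) (P : E -> Prop) (p : nat)
    (net : network E K N p) : Prop :=
  match net with
  | OutputLayer p W b => (forall i j, P (W i j)) /\ (forall i, P (b i 0))
  | HiddenLayer p n W b a net' =>
      [/\ forall i j, P (W i j), forall i, P (b i 0) & all_coefs P net']
  end.

Inductive coef := RatCoef of rat | ComputableCoef of machine.

Definition coef_value (R : realType) (c : coef) (x : R) : Prop :=
  match c with
  | RatCoef q => x = ratr q
  | ComputableCoef M => forall n : nat, exists q : rat,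
      halts_with no_oracle M (write_nats [:: n]) (rat_word q) /\
      `|ratr q - x| <= 2 ^- n
  end.

Definition ser_coef (c : coef) : seq nat :=
  match c with
  | RatCoef q => 0%N :: ser_rat q
  | ComputableCoef M => 1%N :: ser_machine M
  end.

Definition ser_mx (n p : nat) (W : 'M[coef]_(n, p)) : seq nat :=
  flatten [seq ser_coef (W i j) | i <- enum 'I_n, j <- enum 'I_p].

(* The dimensions of the input and of the output are known to the reader and
   every item announces its length, so this code determines the network. *)
Fixpoint ser_network (K N : nat) (p : nat) (net : network coef K N p) : seq nat :=
  match net with
  | OutputLayer p W b => 0%N :: ser_mx W ++ ser_mx b
  | HiddenLayer p n W b a net' =>
      [:: 1%N; n; a : nat] ++ ser_mx W ++ ser_mx b ++ ser_network net'
  end.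

Definition encodes_network (R : realType) (K N m : nat) (act : 'I_K -> R -> R)
    (w : word) (F : 'cV[R]_m -> 'cV[R]_N) : Prop :=
  exists (net : network coef K N m) (val : coef -> R),
    [/\ w = write_nats (ser_network net),
        all_coefs (fun c => coef_value c (val c)) net
      & F = realize act (map_network val net)].

Definition is_neural_network (R : realType) (K N m : nat) (act : 'I_K -> R -> R)
    (F : 'cV[R]_m -> 'cV[R]_N) : Prop :=
  exists net : network R K N m, F = realize act net.

(* The activation functions form a finite set of computable functions that
   contains t |-> t^2 and some extension of t |-> 1/(1+t), t >= 0. *)
Definition admissible_activations (R : realType) (K : nat)
    (act : 'I_K -> R -> R) : Prop :=
  [/\ forall a, computable_function (act a),
      exists a, forall t, act a t = t ^+ 2
    & exists a, forall t, 0 <= t -> act a t = 1 / (1 + t)].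

Definition norm2 (R : realType) (n : nat) (v : 'cV[R]_n) : R :=
  Num.sqrt (\sum_(i < n) v i 0 ^+ 2).

Definition lipschitz_constant (R : realType) (N m : nat)
    (F : 'cV[R]_m -> 'cV[R]_N) : \bar R :=
  ereal_sup [set r : \bar R | exists y y' : 'cV[R]_m,
    y != y' /\ r = (norm2 (F y - F y') / norm2 (y - y'))%:E].

(** * Training sets *)

(* The second component is y^k; the tuple is indexed from 0. *)
Definition training_set (R : realType) (N m l : nat) : Type :=
  'I_l -> 'cV[R]_N * 'cV[R]_m.

Definition training_sets (R : realType) (N m l : nat) (A : 'M[R]_(m, N)) :
    set (training_set R N m l) :=
  [set T | [/\ forall k, norm2 (T k).1 <= 1,
               forall k, norm2 (T k).2 <= 1,
               forall k, (T k).2 = A *m (T k).1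
             & injective T]].

Definition M1 (R : realType) (N m l : nat) (T : training_set R N m l) :
    set 'cV[R]_N :=
  [set x | exists k, x = (T k).1].

Definition pi2 (R : realType) (N m l : nat) (T : training_set R N m l) :
    set 'cV[R]_m :=
  [set y | exists k, y = (T k).2].

Definition union_M2 (R : realType) (N m l : nat) (A : 'M[R]_(m, N))
    (Omega : set (training_set R N m l)) : set 'cV[R]_m :=
  \bigcup_(T in Omega) [set A *m x | x in M1 T].

(* The set $\mathcal{NN}_{m,N}^{\mathcal F}$ and its metric. *)
Definition NN (R : realType) (K N m l : nat) (act : 'I_K -> R -> R)
    (A : 'M[R]_(m, N)) (Omega : set (training_set R N m l)) :
    set ('cV[R]_m -> 'cV[R]_N) :=
  [set F | is_neural_network act F /\
           exists B : R, forall z, union_M2 A Omega z -> norm2 (F z) <= B].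

Definition NN_dist (R : realType) (N m l : nat) (A : 'M[R]_(m, N))
    (Omega : set (training_set R N m l)) (F G : 'cV[R]_m -> 'cV[R]_N) : \bar R :=
  ereal_sup [set (norm2 (F z - G z))%:E | z in union_M2 A Omega].

(** * Optimality *)

Definition dH1 (R : realType) (N : nat) (M : set 'cV[R]_N) (x : 'cV[R]_N) :
    \bar R :=
  ereal_sup [set (norm2 (x' - x))%:E | x' in M].

Definition worst_error (R : realType) (N m : nat) (A : 'M[R]_(m, N))
    (M : set 'cV[R]_N) (phi : 'cV[R]_m -> set 'cV[R]_N) : \bar R :=
  ereal_sup [set dH1 (phi (A *m x)) x | x in M].

Definition c_opt (R : realType) (N m : nat) (A : 'M[R]_(m, N))
    (M : set 'cV[R]_N) : \bar R :=
  ereal_inf [set worst_error A M phi |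
    phi in [set phi : 'cV[R]_m -> set 'cV[R]_N |
              forall z, [set A *m x | x in M] z -> phi z !=set0]].

Definition optimal (R : realType) (N m : nat) (A : 'M[R]_(m, N))
    (M : set 'cV[R]_N) (phi : 'cV[R]_m -> set 'cV[R]_N) : Prop :=
  (worst_error A M phi <= c_opt A M)%E.

Definition Xi (R : realType) (K N m l : nat) (act : 'I_K -> R -> R)
    (A : 'M[R]_(m, N)) (Omega : set (training_set R N m l))
    (T : training_set R N m l) : set ('cV[R]_m -> 'cV[R]_N) :=
  [set F | NN act A Omega F /\ optimal A (M1 T) (fun z => [set F z])].

Definition Xi_lip (R : realType) (K N m l : nat) (act : 'I_K -> R -> R)
    (A : 'M[R]_(m, N)) (Omega : set (training_set R N m l)) (D : R)
    (T : training_set R N m l) : set ('cV[R]_m -> 'cV[R]_N) :=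
  [set F | Xi act A Omega T F /\ (lipschitz_constant F <= D%:E)%E].

(* [None] stands for a computation that does not halt. *)
Definition Xi_error (R : realType) (K N m l : nat) (act : 'I_K -> R -> R)
    (A : 'M[R]_(m, N)) (Omega : set (training_set R N m l))
    (T : training_set R N m l) (o : option ('cV[R]_m -> 'cV[R]_N)) : \bar R :=
  if o is Some F
  then ereal_inf [set NN_dist A Omega F G | G in Xi act A Omega T]
  else +oo%E.

Definition approximates (R : realType) (K N m l : nat) (act : 'I_K -> R -> R)
    (A : 'M[R]_(m, N)) (Omega : set (training_set R N m l))
    (T : training_set R N m l) (eps : R)
    (o : option ('cV[R]_m -> 'cV[R]_N)) : Prop :=
  (Xi_error act A Omega T o <= eps%:E)%E.

(** * Inexact input *)

(* Sequences of approximations are indexed from 0, so that the term of index n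
   approximates to accuracy 2^-(n+1). *)
Definition inexact (N m l : nat) : Type :=
  'I_l -> nat -> 'cV[rat]_N * 'cV[rat]_m.

Definition corresponds (R : realType) (N m l : nat) (iota : inexact N m l)
    (T : training_set R N m l) : Prop :=
  forall (k : 'I_l) (n : nat),
    [/\ forall i, is_dyadic ((iota k n).1 i 0),
        forall j, is_dyadic ((iota k n).2 j 0),
        norm2 (map_mx ratr (iota k n).1 - (T k).1) <= 2 ^- n.+1
      & norm2 (map_mx ratr (iota k n).2 - (T k).2) <= 2 ^- n.+1].

Definition inexact_domain (R : realType) (N m l : nat)
    (Omega : set (training_set R N m l)) : set (inexact N m l) :=
  [set iota | exists2 T, Omega T & corresponds iota T].

Definition input (R : realType) (N m l : nat)
    (Omega : set (training_set R N m l)) : Type :=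
  {iota : inexact N m l | inexact_domain Omega iota}.

(* Read-out functions, named by the training pair, the index in the sequence of
   approximations, and a coordinate of x or of y. *)
Definition readout (N m l : nat) : Type := ('I_l * nat * ('I_N + 'I_m))%type.

Definition read (N m l : nat) (f : readout N m l) (iota : inexact N m l) : rat :=
  match f with
  | (k, n, inl i) => (iota k n).1 i 0
  | (k, n, inr j) => (iota k n).2 j 0
  end.

Definition readout_of (N m l : nat) (s : seq nat) : option (readout N m l) :=
  match s with
  | [:: k; n; 0; i] =>
      if (insub k, insub i) is (Some k', Some i') then Some (k', n, inl i')
      else None
  | [:: k; n; 1; j] =>
      if (insub k, insub j) is (Some k', Some j') then Some (k', n, inr j')
      else None
  | _ => None
  end%N.

Definition input_oracle (N m l : nat) (iota : inexact N m l) : word -> word :=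
  oracle_of (fun s => omap (fun f => read f iota) (readout_of N m l s)).

(** * General algorithms *)

Record general_algorithm (R : realType) (K N m l : nat) (act : 'I_K -> R -> R)
    (A : 'M[R]_(m, N)) (Omega : set (training_set R N m l)) := GeneralAlgorithm {
  ga_out : input Omega -> option ('cV[R]_m -> 'cV[R]_N);
  ga_reads : input Omega -> set (readout N m l);
  ga_range : forall iota F, ga_out iota = Some F -> NN act A Omega F;
  ga_finite : forall iota, ga_out iota <> None -> finite_set (ga_reads iota);
  ga_determined : forall iota iota',
    (forall f, ga_reads iota f -> read f (sval iota') = read f (sval iota)) ->
    ga_out iota' = ga_out iota;
  ga_consistent : forall iota iota',
    (forall f, ga_reads iota f -> read f (sval iota') = read f (sval iota)) ->
    ga_reads iota' = ga_reads iota }.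

(* The open subsets of [NN] for the (pseudo)metric [NN_dist], and the
   sigma-algebra on [NN] that they generate. *)
Definition NN_open (R : realType) (K N m l : nat) (act : 'I_K -> R -> R)
    (A : 'M[R]_(m, N)) (Omega : set (training_set R N m l))
    (U : set ('cV[R]_m -> 'cV[R]_N)) : Prop :=
  U `<=` NN act A Omega /\
  forall F, U F -> exists2 r : R, 0 < r &
    forall G, NN act A Omega G -> (NN_dist A Omega F G < r%:E)%E -> U G.

Definition NN_borel (R : realType) (K N m l : nat) (act : 'I_K -> R -> R)
    (A : 'M[R]_(m, N)) (Omega : set (training_set R N m l)) :
    set (set ('cV[R]_m -> 'cV[R]_N)) :=
  <<s NN act A Omega, NN_open act A Omega >>.

Definition output_measurable (R : realType) (K N m l : nat)
    (act : 'I_K -> R -> R) (A : 'M[R]_(m, N))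
    (Omega : set (training_set R N m l)) :
    set (set (option ('cV[R]_m -> 'cV[R]_N))) :=
  [set S | exists2 B, NN_borel act A Omega B &
     S = Some @` B \/ S = Some @` B `|` [set None]].

(* The collection of general algorithms is the range of [alg], and [e]
   enumerates the read-out functions. *)
Record randomised_general_algorithm (R : realType) (K N m l : nat)
    (act : 'I_K -> R -> R) (A : 'M[R]_(m, N))
    (Omega : set (training_set R N m l)) (e : nat -> readout N m l)
    (d : measure_display) (X : measurableType d)
    (alg : X -> general_algorithm act A Omega)
    (P : input Omega -> probability X R) : Prop := RandomisedGeneralAlgorithm {
  rga_injective : injective alg;
  rga_measurable : forall iota S, output_measurable act A Omega S ->
    measurable [set g | S (ga_out (alg g) iota)];
  rga_reads_measurable : forall iota (n : nat),
    measurable [set g | forall r, ga_reads (alg g) iota (e r) -> (r <= n)%N];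
  rga_consistent : forall (E : set X) iota1 iota2, measurable E ->
    (forall g f, E g -> ga_reads (alg g) iota1 f ->
       read f (sval iota1) = read f (sval iota2)) ->
    P iota1 E = P iota2 E }.

(* Main.v *)
Require Import Defs.
From HB Require Import structures.
From mathcomp Require Import all_boot all_order all_algebra.
From mathcomp Require Import all_classical all_reals all_analysis.
From mathcomp Require Import ring lra.
Set Implicit Arguments.
Unset Strict Implicit.
Unset Printing Implicit Defensive.
Import Order.TTheory GRing.Theory Num.Theory.
Import numFieldNormedType.Exports.
Local Open Scope classical_set_scope.
Local Open Scope ring_scope.

(* Let u be a unit vector of the kernel of A, let e have a non-zero image, and
   put c = 2 eps1.  The training set T_0 consists of points of the segment
   [-2 c u, 2 c u], all with image 0 and including both endpoints, so that its
   optimal radius is 2 c and the zero network is optimal.  In T_t, t > 0, the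
   endpoint 2 c u is moved to c ((2 - t) u + t e), whose image c t A e is no
   longer 0; the optimal radius drops to c, and an optimal network takes values
   near - c u at 0 and near c u at c t A e.  Such a network exists with values of
   norm at most c on all images, so that the zero network has error at most
   2 eps1 for every training set: a machine may write it without reading its
   input.
     On the other hand an algorithm reads a finite part of its input for T_0, on
   which it cannot tell T_0 from T_t with t small.  Its output F then
   approximates optimal networks of all these T_t, and accuracy eps forces
   |F 0 - F (c t A e)| >= 4 eps1 (1 - t) - 2 eps.  For eps < 2 eps1 the slopes of F
   at 0 are unbounded; for eps = eps1 this contradicts the continuity of F,
   since computable activation functions are continuous.  For a randomised
   algorithm the events that F is a good output for T_t have probability bounded
   below as t -> 0, so that some F is good for infinitely many t. *)

(** * The Euclidean norm of column vectors *)

Section EuclideanNorm.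
Context {R : realType}.

Lemma norm2_ge0 n (v : 'cV[R]_n) : 0 <= norm2 v.
Proof. exact: sqrtr_ge0. Qed.

Lemma sumsq_ge0 n (v : 'cV[R]_n) : 0 <= \sum_(i < n) v i 0 ^+ 2.
Proof. by apply: sumr_ge0 => i _; apply: sqr_ge0. Qed.

Lemma norm2Z n (a : R) (v : 'cV[R]_n) : norm2 (a *: v) = `|a| * norm2 v.
Proof.
rewrite /norm2 -sqrtr_sqr -sqrtrM ?sqr_ge0//; congr Num.sqrt.
by rewrite mulr_sumr; apply: eq_bigr => i _; rewrite mxE exprMn.
Qed.

Lemma norm2N n (v : 'cV[R]_n) : norm2 (- v) = norm2 v.
Proof. by rewrite -scaleN1r norm2Z normrN1 mul1r. Qed.

Lemma norm2B n (v w : 'cV[R]_n) : norm2 (v - w) = norm2 (w - v).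
Proof. by rewrite -norm2N opprB. Qed.

Lemma norm2_0 n : norm2 (0 : 'cV[R]_n) = 0.
Proof. by rewrite -(scale0r (0 : 'cV[R]_n)) norm2Z normr0 mul0r. Qed.

Lemma norm2_entry n (v : 'cV[R]_n) i : `|v i 0| <= norm2 v.
Proof.
rewrite -sqrtr_sqr ler_wsqrtr// (bigD1 i)//= lerDl.
by apply: sumr_ge0 => j _; apply: sqr_ge0.
Qed.

Lemma norm2_gt0 n (v : 'cV[R]_n) : v != 0 -> 0 < norm2 v.
Proof.
apply: contraNT; rewrite -leNgt => v0; apply/eqP/colP => i.
by apply/eqP; rewrite mxE -normr_le0 (le_trans (norm2_entry v i)).
Qed.

Lemma norm2_le_sum n (v : 'cV[R]_n) : norm2 v <= \sum_(i < n) `|v i 0|.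
Proof.
have s0 : 0 <= \sum_(i < n) `|v i 0| by apply: sumr_ge0.
rewrite -[leRHS]ger0_norm// -sqrtr_sqr ler_wsqrtr// expr2 mulr_suml.
apply: ler_sum => i _; rewrite -real_normK ?num_real// expr2 ler_wpM2l//.
by rewrite (bigD1 i)//= lerDl; apply: sumr_ge0.
Qed.

(** Lagrange's identity: twice the difference of the squares of the two sides is the double sum of
    the squares of v_i w_j - v_j w_i. *)
Lemma Cauchy_Schwarz_norm2 n (v w : 'cV[R]_n) :
  \sum_(i < n) v i 0 * w i 0 <= norm2 v * norm2 w.
Proof.
apply: le_trans (ler_norm _) _.
rewrite -sqrtr_sqr /norm2 -sqrtrM ?sumsq_ge0// ler_wsqrtr//.
have : 0 <= \sum_(i < n) \sum_(j < n) (v i 0 * w j 0 - v j 0 * w i 0) ^+ 2.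
  by apply: sumr_ge0 => i _; apply: sumr_ge0 => j _; apply: sqr_ge0.
have -> : \sum_(i < n) \sum_(j < n) (v i 0 * w j 0 - v j 0 * w i 0) ^+ 2 =
  ((\sum_(i < n) v i 0 ^+ 2) * (\sum_(i < n) w i 0 ^+ 2) -
   (\sum_(i < n) v i 0 * w i 0) ^+ 2) *+ 2.
  rewrite expr2 !big_distrlr/= mulr2n [X in _ = _ + (X - _)]exchange_big/=.
  rewrite -!sumrB -big_split/=; apply: eq_bigr => i _.
  rewrite -!sumrB -big_split/=; apply: eq_bigr => j _; ring.
by rewrite pmulrn_lge0// subr_ge0.
Qed.

Lemma ler_norm2D n (v w : 'cV[R]_n) : norm2 (v + w) <= norm2 v + norm2 w.
Proof.
rewrite -[leRHS]ger0_norm ?addr_ge0 ?norm2_ge0// -sqrtr_sqr ler_wsqrtr//.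
rewrite sqrrD /norm2 !sqr_sqrtr ?sumsq_ge0// -/(norm2 v) -/(norm2 w).
under eq_bigr do rewrite mxE sqrrD.
rewrite !big_split/= lerD2r lerD2l -mulr2n lerMn2r.
exact: Cauchy_Schwarz_norm2.
Qed.

Lemma ler_norm2B n (v w x : 'cV[R]_n) :
  norm2 (v - x) <= norm2 (v - w) + norm2 (w - x).
Proof. by rewrite -[v - x](subrKA w) ler_norm2D. Qed.

End EuclideanNorm.

(** * A Turing machine with constant output *)

Section ConstantMachine.
Variables (a : nat) (w : word).

(* The first step erases the first symbol [a] of the input, the following ones
   write [w] from right to left on the blank cells to the left of it. *)
Definition writer_instruction (j : nat) : instruction :=
  Instruction (if j is 0 then start_state else j.+2) (if j is 0 then a else blank)
    blank j.+3 (if j is j'.+1 then nth blank (rev w) j' else blank)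
    (if (j <= size w)%N then MoveLeft else MoveRight) blank Stay.

Definition writer : machine :=
  [seq writer_instruction j | j <- iota 0 (size w).+2].

(** The last [j] letters of [w] are written and the head is on the blank cell to their left; the
    blank before [v] is the erased first symbol of the input. *)
Let writer_config (v : word) (j : nat) : config :=
  Config j.+3 (Tape [::] blank (drop (size w - j) w ++ blank :: v))
    (Tape [::] blank [::]).

(** The instructions start from the distinct states 0, 3, 4, ..., so that at most one applies; 1 and
    2 are skipped because they are the query and answer states. *)
Lemma step_writer O (c : config) (j : nat) :
  (state c != query_state) -> (j < (size w).+2)%N ->
  applicable c (writer_instruction j) ->
  step O writer c = Some (execute c (writer_instruction j)).
Proof.
move=> qc jw cj; rewrite /step (negbTE qc) /writer filter_map.
rewrite (_ : seq.filter _ _ = [:: j])//.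
rewrite -(filter_pred1_uniq (iota_uniq 0 (size w).+2)) ?mem_iota//.
apply: eq_in_filter => i _ /=; apply/idP/eqP => [|->//].
move: cj; rewrite /applicable => /and3P[/eqP + _ _] /and3P[/eqP + _ _] => <-.
by case: i j {jw} => [|i] [|j]//= [->].
Qed.

Lemma writer_halts O (w0 : word) : ohead w0 = Some a -> blank \notin w ->
  halts_with O writer w0 w.
Proof.
case: w0 => [//|x v] [-> {x}] bw.
have step0 : step O writer (initial (a :: v)) = Some (writer_config v 0).
  rewrite (@step_writer _ _ 0)//= /applicable/= ?eqxx//.
  by rewrite /execute/= /writer_config subn0 drop_size.
have stepS j : (j < size w)%N ->
    step O writer (writer_config v j) = Some (writer_config v j.+1).
  move=> jw; rewrite (@step_writer _ _ j.+1) ?/applicable/= ?eqxx ?ltnS ?(ltnW jw)//.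
  rewrite /execute/= jw /writer_config nth_rev//; congr (Some (Config _ _ _)).
  congr Tape; rewrite -cat_cons; congr (_ ++ _).
  by rewrite [RHS](drop_nth blank) ?subnSK ?leq_subr.
have reach j : (j <= size w)%N ->
    iter j.+1 (obind (step O writer)) (Some (initial (a :: v))) =
    Some (writer_config v j).
  elim: j => [|j IH] jw; first by rewrite /= step0.
  by rewrite iterS IH ?(ltnW jw)//= stepS.
(* The last instruction looks beyond the end of [rev w], so it writes the default [blank]; it moves
   right to the cell where [w] starts and enters a state without instructions. *)
exists (size w).+2; eexists; split.
- rewrite iterS reach//= (@step_writer _ _ (size w).+1) ?/applicable/= ?eqxx//.
- rewrite /execute/= ltnn /step/= /writer filter_map (_ : seq.filter _ _ = [::])//.
  apply/eqP; rewrite -(negbK (_ == _)) -has_filter; apply/hasPn => j.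
  rewrite mem_iota /= => jw; rewrite /applicable/=.
  apply/negP => /andP[/eqP + _]; case: j jw => [|j]//= jw [jE].
  by rewrite jE !ltnS ltnn in jw.
rewrite /execute/= ltnn/= subnn drop0 /tape_word.
simpl head_cell; simpl right_cells.
have -> : head blank (w ++ blank :: v) :: behead (w ++ blank :: v) =
  w ++ blank :: v by case: (w).
by rewrite index_cat (negbTE bw)/= addn0 take_size_cat.
Qed.

End ConstantMachine.

(** * Codes of numbers, determinism and finite use of the oracle *)

Lemma binary_nonblank (n : nat) : blank \notin binary n.
Proof.
rewrite /binary; case: (bin_of_nat n) => // p.
by elim: p => [p IH|p IH|]//=; rewrite mem_rcons inE negb_or IH.
Qed.

Lemma write_nats_nonblank (s : seq nat) : blank \notin write_nats s.
Proof.
elim: s => [|n s IH]//.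
by rewrite /write_nats/= mem_cat mem_rcons inE !negb_or binary_nonblank.
Qed.

(** The sign flag is then 0, whose numeral is empty. This fixes the symbol that [writer] has to
    expect on its input. *)
Lemma rat_word_head (q : rat) : 0 <= q -> ohead (rat_word q) = Some separator.
Proof.
rewrite -numq_ge0 => q0; rewrite /rat_word /ser_rat /ser_int.
by rewrite ltNge q0.
Qed.

Lemma rat_word_inj : injective rat_word.
Proof.
move=> p q /(can_inj write_natsK); rewrite /ser_rat /ser_int/= => -[sE nE dE].
rewrite -(divq_num_den p) -(divq_num_den q).
have -> : denq p = denq q.
  by rewrite -(gez0_abs (denq_ge0 p)) -(gez0_abs (denq_ge0 q)) dE.
congr (_%:~R / _).
by rewrite (intEsign (numq p)) (intEsign (numq q)) nE (can_inj oddb sE).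
Qed.

(** After a halt the iteration stays at [None], so two halting runs have the same length and the
    same final configuration. *)
Lemma halts_with_inj O M w v v' :
  halts_with O M w v -> halts_with O M w v' -> v = v'.
Proof.
have halted n c n' c' :
    iter n (obind (step O M)) (Some (initial w)) = Some c ->
    step O M c = None ->
    iter n' (obind (step O M)) (Some (initial w)) = Some c' -> (n' <= n)%N.
  move=> nc c0 n'c'; rewrite leqNgt; apply/negP => nn'.
  move: n'c'; rewrite -(subnK nn') iterD iterS nc/= c0.
  suff -> : iter (n' - n.+1) (obind (step O M)) None = None by [].
  by elim: (n' - n.+1)%N => //= k ->.
move=> [n [c [nc c0 <-]]] [n' [c' [n'c' c'0 <-]]].
have nn' : n = n'.
  by apply/eqP; rewrite eqn_leq (halted _ _ _ _ n'c' c'0 nc) (halted _ _ _ _ nc c0 n'c').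
by move: nc; rewrite nn' n'c' => -[->].
Qed.

Lemma exists_seq_bound (s : seq nat) :
  exists Q, forall k, s = [:: k] -> (k < Q)%N.
Proof. by case: s => [|k [|]]; [exists 0%N| exists k.+1 => ? [->]|exists 0%N]. Qed.

(** Each step consults at most one value of [phi], and a halting run has finitely many steps; [Q]
    bounds the indices consulted. *)
Lemma halts_with_finite_use (M : machine) (w v : word) (phi : nat -> rat) :
  let O phi := oracle_of (fun s => if s is [:: k] then Some (phi k) else None) in
  halts_with (O phi) M w v ->
  exists Q, forall phi', (forall k, (k < Q)%N -> phi' k = phi k) ->
    halts_with (O phi') M w v.
Proof.
move=> O.
have step_use c : exists Q, forall phi',
    (forall k, (k < Q)%N -> phi' k = phi k) -> step (O phi') M c = step (O phi) M c.
  rewrite /step; case: ifP => _; last by exists 0%N.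
  have [Q Qs] := exists_seq_bound (read_nats (tape_word (oracle c))).
  exists Q => phi' phiE; rewrite /O /oracle_of.
  move: Qs; case: (read_nats _) => [|k [|]]// Qs.
  by rewrite phiE// Qs.
move=> [n [c [nc c0 cv]]].
have [Q0 Q0P] := step_use c.
have [Q1 Q1P] : exists Q, forall phi', (forall k, (k < Q)%N -> phi' k = phi k) ->
    iter n (obind (step (O phi') M)) (Some (initial w)) =
    iter n (obind (step (O phi) M)) (Some (initial w)).
  elim: n {nc} => [|n [Q QP]]; first by exists 0%N.
  case nE: (iter n (obind (step (O phi) M)) (Some (initial w))) => [c'|]; last first.
    by exists Q => phi' phiE; rewrite !iterS QP// nE.
  have [Q' Q'P] := step_use c'.
  exists (maxn Q Q') => phi' phiE; rewrite !iterS QP ?nE/= ?Q'P// => k kQ;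
    by rewrite phiE// leq_max kQ ?orbT.
exists (maxn Q0 Q1) => phi' phiE; exists n, c; split => //.
  by rewrite Q1P// => k kQ; rewrite phiE// leq_max kQ orbT.
by rewrite Q0P// => k kQ; rewrite phiE// leq_max kQ.
Qed.

(** * Dyadic approximation and continuity of networks *)

Section Dyadic.
Context {R : realType}.

Lemma exists_half_pow (e : R) : 0 < e -> exists n, 2 ^- n < e.
Proof.
move=> e0; exists (Num.bound e^-1); rewrite invf_plt ?posrE ?exprn_gt0//.
apply: lt_trans (archi_boundP _) _; first by rewrite invr_ge0 ltW.
by rewrite -natrX ltr_nat ltn_expl.
Qed.

Lemma half_powS n : 2 ^- n.+1 + 2 ^- n.+1 = 2 ^- n :> R.
Proof. rewrite exprS; field; by rewrite expf_eq0 ?pnatr_eq0 ?andbF. Qed.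

Lemma half_pow_le m n : (m <= n)%N -> 2 ^- n <= 2 ^- m :> R.
Proof.
by move=> mn; rewrite lef_pV2 ?posrE ?exprn_gt0// ler_eXn2l// ltr1n.
Qed.

Lemma half_pow_gt0 n : 0 < 2 ^- n :> R.
Proof. by rewrite invr_gt0 exprn_gt0. Qed.

Lemma half_pow_le1 n : 2 ^- n <= 1 :> R.
Proof. by rewrite (le_trans (half_pow_le (leq0n n)))// expr0 invr1. Qed.

Lemma half_pow_itv n : 0 <= (2 ^- n : R) <= 1.
Proof. by rewrite half_pow_le1 ltW// half_pow_gt0. Qed.

Lemma exists_dyadic (r : R) n :
  exists q : rat, is_dyadic q /\ `|ratr q - r| <= 2 ^- n.
Proof.
have h0 := half_pow_gt0 n; pose z := Num.floor (r * 2 ^+ n).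
exists (z%:~R / 2 ^+ n); split; first by exists z, n.
have -> : ratr (z%:~R / 2 ^+ n) = z%:~R / 2 ^+ n :> R.
  by rewrite rmorphM/= fmorphV/= rmorphXn/= ratr_int rmorph_nat.
have /andP[zl zr] := floor_itv (r * 2 ^+ n).
have rE : r = r * 2 ^+ n / 2 ^+ n.
  by rewrite mulfK// expf_eq0 pnatr_eq0 andbF.
rewrite {1}rE -mulrBl normrM (gtr0_norm h0) -[leRHS]mul1r ler_pM2r// -/z.
rewrite distrC ger0_norm ?subr_ge0// lerBlDl ltW//.
by rewrite (lt_le_trans zr)// intrD.
Qed.

Lemma exists_dyadic_vector p (v : 'cV[R]_p) n : exists q : 'cV[rat]_p,
  (forall i, is_dyadic (q i 0)) /\ norm2 (map_mx ratr q - v) <= 2 ^- n.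
Proof.
(* The [p] extra bits absorb the sum over the [p] coordinates, since p <= 2^p. *)
have [q qP] := choice (fun i => exists_dyadic (v i 0) (n + p)).
exists (\col_i q i); split=> [i|]; first by rewrite mxE; have [] := qP i.
apply: le_trans (norm2_le_sum _) _.
apply: (@le_trans _ _ (\sum_(i < p) 2 ^- (n + p))).
  by apply: ler_sum => i _; rewrite !mxE; have [] := qP i.
rewrite sumr_const card_ord -(mulr_natl _ p) exprD invfM mulrCA.
rewrite ler_piMr ?(ltW (half_pow_gt0 _))//.
by rewrite ler_pdivrMr ?exprn_gt0// mul1r -natrX ler_nat ltnW// ltn_expl.
Qed.

(* On an input close to t, the machine may be given the same initial terms as
   for t; by finite use it then computes the same answer. *)
Lemma computable_continuous (f : R -> R) (t : R) :
  computable_function f -> {for t, continuous f}.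
Proof.
move=> [M MP]; apply/cvgrPdist_le => e e0.
have [n ne] := exists_half_pow e0.
(* The spare bit keeps the first [Q] terms valid as approximations of every [s] within 2^-(Q+1) of
   [t]. *)
have [phi phiP] := choice (fun k => exists_dyadic t k.+1).
have phit k : is_dyadic (phi k) /\ `|ratr (phi k) - t| <= 2 ^- k.
  have [? kt] := phiP k; split=> //; apply: le_trans kt _; exact: half_pow_le.
have [q [Mq qt]] := MP t phi phit n.+1.
have [Q QP] := halts_with_finite_use Mq.
exists (2 ^- Q.+1); first exact: half_pow_gt0.
move=> s /= ts.
have [psi psiP] := choice (exists_dyadic s).
pose phi' k := if (k < Q)%N then phi k else psi k.
have phis k : is_dyadic (phi' k) /\ `|ratr (phi' k) - s| <= 2 ^- k.
  rewrite /phi'; case: ifPn => // kQ; have [? kt] := phiP k; split=> //.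
  rewrite -(subrKA t) (le_trans (ler_normD _ _))// -half_powS lerD//.
  by apply: le_trans (ltW ts) _; apply: half_pow_le; rewrite ltnS ltnW.
have [q' [Mq' qs]] := MP s phi' phis n.+1.
have /QP Mq2 : forall k, (k < Q)%N -> phi' k = phi k by move=> k; rewrite /phi' => ->.
have qq' := rat_word_inj (halts_with_inj Mq2 Mq'); rewrite -{}qq' in qs.
apply: le_trans (ltW ne); rewrite -half_powS -(subrKA (ratr q)).
by rewrite (le_trans (ler_normD _ _))// lerD// distrC.
Qed.

(** Induction on the layers: in the stacked vector the old coordinates converge by assumption, the
    new ones by continuity of the activation function. *)
Lemma network_cvg K N (act : 'I_K -> R -> R) p (net : network R K N p)
    (z : nat -> 'cV[R]_p) (l : 'cV[R]_p) :
  (forall a, continuous (act a)) ->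
  (forall i, z n i 0 @[n --> \oo] --> l i 0) ->
  forall i, realize act net (z n) i 0 @[n --> \oo] --> realize act net l i 0.
Proof.
move=> act_cont.
have affine_cvg q r (W : 'M[R]_(q, r)) (b : 'cV[R]_q) (y : nat -> 'cV[R]_r)
      (l' : 'cV[R]_r) :
    (forall i, y n i 0 @[n --> \oo] --> l' i 0) ->
    forall i, (W *m y n + b) i 0 @[n --> \oo] --> (W *m l' + b) i 0.
  move=> yl i; rewrite !mxE; under eq_fun do rewrite !mxE.
  apply: cvgD; last exact: cvg_cst.
  apply: cvg_big => [x|j _]; first exact: (add_continuous (s := R) x).
  by apply: cvgM; [exact: cvg_cst|exact: yl].
elim: net z l => [q W b|q n W b a net IH] z l zl /=; first exact: affine_cvg.
apply: (IH (fun k => col_mx (z k) (map_mx (act a) (W *m z k + b)))) => i.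
rewrite -(splitK i); case: (fintype.split i) => j /=.
  by rewrite col_mxEu; under eq_fun do rewrite col_mxEu; exact: zl.
rewrite col_mxEd mxE; under eq_fun do rewrite col_mxEd mxE.
apply: (@continuous_cvg _ _ _ _ _ (fun k => (W *m z k + b) j 0) (act a)); first exact: act_cont.
exact: affine_cvg.
Qed.

End Dyadic.

(** * Optimal maps and the radius of fibres *)

Section Optimality.
Context {R : realType} {N m : nat} (A : 'M[R]_(m, N)).
Implicit Types (M : set 'cV[R]_N) (F G : 'cV[R]_m -> 'cV[R]_N) (x : 'cV[R]_N).

(** By the triangle inequality, a value of [phi] at the common image is at distance at least [r]
    from [x] or from [x']. *)
Lemma c_opt_ge M x x' (r : R) : M x -> M x' -> A *m x = A *m x' ->
  r *+ 2 <= norm2 (x - x') -> (r%:E <= c_opt A M)%E.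
Proof.
move=> Mx Mx' Axx' rxx'; apply: le_ereal_inf_tmp => _ [phi phi0 <-].
have [z phiz] : phi (A *m x) !=set0 by apply: phi0; exists x.
have err x0 : M x0 -> A *m x = A *m x0 -> r <= norm2 (z - x0) ->
    (r%:E <= worst_error A M phi)%E.
  move=> Mx0 Axx0 rz; apply: le_ereal_sup_tmp.
  exists (dH1 (phi (A *m x0)) x0); first by exists x0.
  apply: le_ereal_sup_tmp; exists (norm2 (z - x0))%:E; last by rewrite lee_fin.
  by exists z; rewrite // -Axx0.
have [rzx|zxr] := leP r (norm2 (z - x)); first exact: err rzx.
apply: (err x') => //; rewrite leNgt; apply/negP => zx'r.
have := ler_norm2B x z x'; rewrite (norm2B x z) leNgt => /negP; apply.
by rewrite (lt_le_trans _ rxx')// mulr2n ltrD.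
Qed.

Lemma worst_error_le M F (r : R) :
  (worst_error A M (fun z => [set F z]) <= r%:E)%E <->
  forall x, M x -> norm2 (F (A *m x) - x) <= r.
Proof.
split=> [Fr x Mx|Fr].
  rewrite -lee_fin; apply: le_trans Fr.
  apply: le_ereal_sup_tmp; exists (dH1 [set F (A *m x)] x); first by exists x.
  by apply: ereal_sup_ubound; exists (F (A *m x)).
apply: ge_ereal_sup => _ [x Mx <-]; apply: ge_ereal_sup => _ [_ -> <-].
by rewrite lee_fin Fr.
Qed.

Lemma optimal_from_pair M F x x' (r : R) :
  M x -> M x' -> A *m x = A *m x' -> r *+ 2 <= norm2 (x - x') ->
  (forall x0, M x0 -> norm2 (F (A *m x0) - x0) <= r) ->
  optimal A M (fun z => [set F z]).
Proof.
move=> Mx Mx' Axx' rxx' /worst_error_le Fr.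
exact: le_trans Fr (c_opt_ge Mx Mx' Axx' rxx').
Qed.

(** [G] is a competitor in the infimum [c_opt]. One good network thus controls all optimal ones. *)
Lemma optimal_error_le M F G (r : R) :
  optimal A M (fun z => [set F z]) ->
  (forall x, M x -> norm2 (G (A *m x) - x) <= r) ->
  forall x, M x -> norm2 (F (A *m x) - x) <= r.
Proof.
move=> optF Gr; apply/worst_error_le; apply: le_trans optF _.
apply: (@le_trans _ _ (worst_error A M (fun z => [set G z]))).
  by apply: ereal_inf_lbound; exists (fun z => [set G z]) => // z _; exists (G z).
exact/worst_error_le.
Qed.

End Optimality.

(** * Distance to the set of optimal networks *)

Section Approximation.
Context {R : realType} {K N m l : nat} (act : 'I_K -> R -> R) (A : 'M[R]_(m, N)).
Context (Omega : set (training_set R N m l)).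
Implicit Types (T : training_set R N m l) (F G : 'cV[R]_m -> 'cV[R]_N).

Lemma NN_dist_ge F G z : union_M2 A Omega z ->
  ((norm2 (F z - G z))%:E <= NN_dist A Omega F G)%E.
Proof. by move=> Oz; apply: ereal_sup_ubound; exists z. Qed.

Lemma NN_dist_le F G (r : R) :
  (forall z, union_M2 A Omega z -> norm2 (F z - G z) <= r) ->
  (NN_dist A Omega F G <= r%:E)%E.
Proof. by move=> FG; apply: ge_ereal_sup => _ [z Oz <-]; rewrite lee_fin FG. Qed.

Lemma approximates_from_witness T F G (eps : R) :
  Xi act A Omega T G ->
  (forall z, union_M2 A Omega z -> norm2 (F z - G z) <= eps) ->
  approximates act A Omega T eps (Some F).
Proof.
move=> XG FG; apply: ge_ereal_inf; exists (NN_dist A Omega F G); first by exists G.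
exact: NN_dist_le.
Qed.

(** The number norm2 (F z - p) - r is below the distance from [F] to each optimal [G], hence below
    the infimum, attained or not. *)
Lemma approximates_dist_le T F (eps r : R) z p :
  approximates act A Omega T eps (Some F) -> union_M2 A Omega z ->
  (forall G, Xi act A Omega T G -> norm2 (G z - p) <= r) ->
  norm2 (F z - p) <= eps + r.
Proof.
move=> Feps Oz Gr; rewrite -lerBlDr -lee_fin; apply: le_trans Feps.
apply: le_ereal_inf_tmp => _ [G XG <-]; apply: le_trans (NN_dist_ge _ _ Oz).
by rewrite lee_fin lerBlDr (le_trans (ler_norm2B _ (G z) _))// lerD2l Gr.
Qed.

(** The complement in [NN] is open: if the error of [F] is at least eps + 2 r, every network at
    distance less than [r] from [F] still has error at least eps + r. *)
Lemma approximates_borel T (eps : R) :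
  NN_borel act A Omega
    [set F | NN act A Omega F /\ approximates act A Omega T eps (Some F)].
Proof.
set B := [set F | _].
have -> : B = NN act A Omega `\` (NN act A Omega `\` B).
  by rewrite setDD; apply/seteqP; split => F // [].
apply: sigma_algebraCD; apply: sub_sigma_algebra; split; first exact: subDsetl.
move=> F [NF /= BF].
have [r r0 rF] : exists2 r : R, 0 < r &
    ((eps + (r + r))%:E <= Xi_error act A Omega T (Some F))%E.
  have : (eps%:E < Xi_error act A Omega T (Some F))%E.
    by rewrite ltNge; apply/negP => ?; apply: BF.
  case: (Xi_error _ _ _ _ _) => [s||]//= epss; last first.
    by exists 1; rewrite ?ltr01 ?leey.
  exists ((s - eps) / 2); first by rewrite divr_gt0// subr_gt0.
  by rewrite -splitr addrC subrK.
exists r => // F' NF' FF'; split=> // -[_].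
apply/negP; rewrite -ltNge; apply: (@lt_le_trans _ _ (eps + r)%:E).
  by rewrite lte_fin ltrDl.
apply: le_ereal_inf_tmp => _ [G XG <-].
have : ((eps + (r + r))%:E <= r%:E + NN_dist A Omega F' G)%E.
  apply: le_trans (le_trans rF _) _.
    by apply: ereal_inf_lbound; exists G.
  apply: ge_ereal_sup => _ [z Oz <-].
  apply: le_trans (leeD (le_trans (NN_dist_ge _ _ Oz) (ltW FF')) (NN_dist_ge _ _ Oz)).
  by rewrite -EFinD lee_fin ler_norm2B.
by rewrite addrA (addrC (eps + r)) EFinD leeD2lE.
Qed.

End Approximation.

(** * Inexact inputs that agree up to a given index *)

Section InexactInput.
Context {R : realType} {N m l : nat}.
Implicit Types (T : training_set R N m l) (iota : inexact N m l).

(* Correspondence with one spare bit of accuracy, so that an initial segment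
   of the input also corresponds to every nearby training set. *)
Definition finely_corresponds iota T : Prop := forall k n,
  [/\ forall i, is_dyadic ((iota k n).1 i 0),
      forall j, is_dyadic ((iota k n).2 j 0),
      norm2 (map_mx ratr (iota k n).1 - (T k).1) <= 2 ^- n.+2
    & norm2 (map_mx ratr (iota k n).2 - (T k).2) <= 2 ^- n.+2].

Lemma exists_finely_corresponds T : exists iota, finely_corresponds iota T.
Proof.
have [x xP] := choice (fun kn : 'I_l * nat => exists_dyadic_vector (T kn.1).1 kn.2.+2).
have [y yP] := choice (fun kn : 'I_l * nat => exists_dyadic_vector (T kn.1).2 kn.2.+2).
exists (fun k n => (x (k, n), y (k, n))) => k n.
by have [? ?] := xP (k, n); have [? ?] := yP (k, n).
Qed.

Lemma finely_corresponds_weaken iota T :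
  finely_corresponds iota T -> corresponds iota T.
Proof.
move=> iotaT k n; have [? ? x y] := iotaT k n.
by split=> //; [apply: le_trans x _|apply: le_trans y _]; exact: half_pow_le.
Qed.

(** The terms up to index [q] come from [iota], the later ones from an approximation of [T']. For n
    <= q the two errors 2^-(n+2) and 2^-(q+2) add up to at most 2^-(n+1). *)
Lemma corresponds_splice iota T T' (q : nat) :
  finely_corresponds iota T ->
  (forall k, norm2 ((T k).1 - (T' k).1) <= 2 ^- q.+2 /\
             norm2 ((T k).2 - (T' k).2) <= 2 ^- q.+2) ->
  exists iota', corresponds iota' T' /\
    forall k n, (n <= q)%N -> iota' k n = iota k n.
Proof.
move=> iotaT TT'; have [kappa kappaT'] := exists_finely_corresponds T'.
exists (fun k n => if (n <= q)%N then iota k n else kappa k n).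
split=> [k n|k n ->//]; case: ifPn => [nq|_]; last exact: finely_corresponds_weaken.
have [? ? x y] := iotaT k n; have [Tx Ty] := TT' k.
have qn : 2 ^- q.+2 <= 2 ^- n.+2 :> R by exact: half_pow_le.
by split=> //; rewrite -half_powS; [apply: le_trans (ler_norm2B _ (T k).1 _) _|
  apply: le_trans (ler_norm2B _ (T k).2 _) _]; rewrite lerD// (le_trans _ qn).
Qed.

Lemma finite_readouts_bounded (S : set (readout N m l)) : finite_set S ->
  exists q, forall f, S f -> (f.1.2 <= q)%N.
Proof.
move=> /finite_seqP[s ->]; exists (\max_(f <- s) f.1.2)%N => f fs.
exact: leq_bigmax_seq.
Qed.

End InexactInput.

(** * Limits of network values and of events *)

Lemma neural_network_gap (R : realType) (K N m : nat) (act : 'I_K -> R -> R)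
    (F : 'cV[R]_m -> 'cV[R]_N) (a : nat -> R) (v : 'cV[R]_m) :
  admissible_activations act -> is_neural_network act F ->
  a n @[n --> \oo] --> (0 : R) ->
  norm2 (F 0 - F (a n *: v)) @[n --> \oo] --> (0 : R).
Proof.
move=> [act_comp _ _] [net ->] a0; rewrite -(@norm2_0 R N) -(subrr (realize act net 0)).
apply: (@continuous_cvg _ _ _ _ _
  (fun n => \sum_(i < N) (realize act net 0 - realize act net (a n *: v)) i 0 ^+ 2)
  Num.sqrt); first exact: sqrt_continuous.
apply: cvg_big => [x|i _]; first exact: (add_continuous (s := R) x).
apply: (@continuous_cvg _ _ _ _ _
  (fun n => (realize act net 0 - realize act net (a n *: v)) i 0)
  (fun x : R => x ^+ 2)); first exact: exprn_continuous.
rewrite !mxE; under eq_fun do rewrite !mxE.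
apply: cvgB; first exact: cvg_cst.
apply: network_cvg => [b t|j]; first exact: computable_continuous.
rewrite mxE -(mul0r (v j 0)); under eq_fun do rewrite mxE.
by apply: cvgM => //; exact: cvg_cst.
Qed.

Lemma half_pow_cvg (R : realType) (c : R) :
  c * 2 ^- n.+2 @[n --> \oo] --> (0 : R).
Proof.
have half1 : `|2^-1 : R| < 1 by rewrite ger0_norm ?invf_lt1 ?ltr1n ?invr_ge0.
rewrite (_ : (fun n => _) = geometric (c * 2^-1 ^+ 2) 2^-1).
  exact: cvg_geometric.
by apply: funext => n /=; rewrite -mulrA -exprD add2n exprVn.
Qed.

(** Since S is covered by S [&] T and the complement of T, P (S [&] T) >= P S + P T - 1. *)
Lemma probability_setI_ge d (X : measurableType d) (R : realType)
    (P : probability X R) (S T : set X) (p : R) :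
  measurable S -> measurable T -> (p%:E < P S)%E -> (p%:E < P T)%E ->
  ((2 * p - 1)%:E <= P (S `&` T))%E.
Proof.
move=> mS mT; have mST := measurableI _ _ mS mT; have mTC := measurableC mT.
have : (P S <= P (S `&` T) + P (~` T))%E.
  apply: (@le_trans _ _ (P ((S `&` T) `|` ~` T))).
    apply: le_measure; rewrite ?inE; [exact: mS|exact: measurableU|].
    by move=> x Sx; have [Tx|Tx] := pselect (T x); [left|right].
  exact: measureU2.
rewrite probability_setC//.
rewrite -(fineK (fin_num_measure P _ mS)) -(fineK (fin_num_measure P _ mT)).
rewrite -(fineK (fin_num_measure P _ mST)) -EFinB -EFinD !lte_fin !lee_fin; lra.
Qed.

(** The tail unions have probability at least [a] and decrease to the limit superior, whose
    probability is therefore positive. *)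
Lemma lim_sup_set_nonempty d (X : measurableType d) (R : realType)
    (P : probability X R) (F : nat -> set X) (a : R) :
  (forall n, measurable (F n)) -> 0 < a -> (forall n, (a%:E <= P (F n))%E) ->
  lim_sup_set F !=set0.
Proof.
move=> mF a0 aF; apply/set0P/negP => /eqP F0.
have mU n : measurable (\bigcup_(k in [set k | (n <= k)%N]) F k).
  exact: bigcup_measurable.
have := @lim_sup_set_cvg _ _ _ P F mF.
rewrite F0 measure0 => /(_ (le_lt_trans (probability_le1 P (mU 0%N)) (ltry 1))).
move=> PF0; have : (a%:E <= (0 : \bar R))%E.
  rewrite -(cvg_lim _ PF0)//; apply: lime_ge; first by apply/cvg_ex; eexists; exact: PF0.
  apply: nearW => n; apply: le_trans (aF n) _.
  by apply: le_measure; rewrite ?inE//; apply: bigcup_sup => /=.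
by rewrite leNgt lte_fin a0.
Qed.

(** * Constant networks and networks with values on a segment *)

Section Networks.
Context {R : realType} {K N m : nat} (act : 'I_K -> R -> R).
Hypothesis hact : admissible_activations act.

Lemma cst_neural_network (b : 'cV[R]_N) :
  is_neural_network act (fun _ : 'cV[R]_m => b).
Proof.
exists (OutputLayer K (0 : 'M[R]_(N, m)) b).
by apply: funext => y /=; rewrite mul0mx add0r.
Qed.

(* With [a = 1 / (1 + g y)] the weight of [p - q] is [(2 * a - 1) ^ 2]; the
   square keeps the values on the segment [p, q], whatever [g y >= 0] is. *)
Lemma segment_neural_network (g : 'rV[R]_m) (p q : 'cV[R]_N) :
  exists2 F, is_neural_network act F & forall y, 0 <= (g *m y) 0 0 ->
    F y = q + ((1 - (g *m y) 0 0) / (1 + (g *m y) 0 0)) ^+ 2 *: (p - q).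
Proof.
have [_ [asq sqE] [ainv invE]] := hact.
pose net := HiddenLayer g 0 ainv
  (HiddenLayer (row_mx 0 2%:M : 'M[R]_(1, m + 1)) (const_mx (-1)) asq
    (OutputLayer K (row_mx 0 (p - q) : 'M[R]_(N, m + 1 + 1)) q)).
exists (realize act net); first by exists net.
move=> y gy0; rewrite /= !mul_row_col !mul0mx !add0r addr0 addrC; congr (_ + _).
rewrite mul_scalar_mx.
set s := (g *m y) 0 0 in gy0 *.
have -> : map_mx (act asq) (2 *: map_mx (act ainv) (g *m y) + const_mx (-1)) =
    (((1 - s) / (1 + s)) ^+ 2)%:M.
  apply/matrixP => i j; rewrite !ord1 mxE sqE [RHS]mxE eqxx mulr1n.
  rewrite mxE [X in X + _]mxE [X in _ * X]mxE [X in _ + X]mxE invE -/s//.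
  congr (_ ^+ 2).
  by field; rewrite gt_eqF// ltr_wpDr.
by rewrite mul_mx_scalar.
Qed.

End Networks.

(** * The family of training sets and its optimal networks *)

Section TrainingFamily.
Context {R : realType} {K N m l : nat} (act : 'I_K -> R -> R) (A : 'M[R]_(m, N)).
Hypothesis hact : admissible_activations act.
Variables (u e : 'cV[R]_N) (c : R).
Hypothesis l_gt2 : (2 < l)%N.
Hypothesis Au0 : A *m u = 0.
Hypothesis u1 : norm2 u = 1.
Hypothesis e1 : norm2 e <= 1.
Hypothesis Ae_neq0 : A *m e != 0.
Hypothesis Ae1 : norm2 (A *m e) <= 1.
Hypothesis c_gt0 : 0 < c.
Hypothesis c_le : 2 * c <= 1.

Let c_ge0 : 0 <= c. Proof. exact: ltW. Qed.

(** Equally spaced from 0 at k = 1 to 1 at k = l - 1; the index 0 is treated separately in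
    [point]. *)
Definition weight (k : 'I_l) : R := k.-1%:R / l.-2%:R.

Let l2_gt0 : 0 < l.-2%:R :> R.
Proof. by rewrite ltr0n; case: (l) l_gt2 => [|[|[|]]]. Qed.

Lemma weight_ge0 k : 0 <= weight k.
Proof. by rewrite divr_ge0. Qed.

Lemma weight_le1 k : weight k <= 1.
Proof.
rewrite ler_pdivrMr// mul1r ler_nat.
by case: k => [[|k] kl]//=; case: (l) kl => [|[|l']].
Qed.

(* The fibre over 0 of the limit [t = 0] is a subset of the segment
   [-2 * c * u, 2 * c * u] containing its endpoints; for [t > 0] the endpoint
   [2 * c * u] leaves the fibre and the remaining points have centre
   [- c * u] and radius [c]. *)
Definition point (t : R) (k : 'I_l) : 'cV[R]_N :=
  if k == 0%N :> nat then c *: ((2 - t) *: u + t *: e) else (- (2 * c * weight k)) *: u.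

Definition family (t : R) : training_set R N m l :=
  fun k => (point t k, A *m point t k).

Lemma image_point t k :
  A *m point t k = if k == 0%N :> nat then (c * t) *: (A *m e) else 0.
Proof.
rewrite /point; case: ifP => _; rewrite -?scalemxAr ?Au0 ?scaler0//.
by rewrite mulmxDr -!scalemxAr Au0 scaler0 add0r scalerA.
Qed.

Lemma norm2_point t k : 0 <= t <= 1 -> norm2 (point t k) <= 2 * c.
Proof.
move=> /andP[t0 t1]; rewrite /point; case: ifP => _; rewrite norm2Z.
  rewrite ger0_norm// mulrC ler_pM2r//.
  apply: le_trans (ler_norm2D _ _) _; rewrite !norm2Z u1 mulr1.
  rewrite (ger0_norm t0) ger0_norm; last lra.
  have := ler_wpM2l t0 e1; lra.
rewrite u1 mulr1 normrN ger0_norm ?mulr_ge0 ?weight_ge0//.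
by rewrite ler_piMr ?weight_le1// mulr_ge0.
Qed.

Lemma family_training_set t : 0 <= t <= 1 -> training_sets A (family t).
Proof.
move=> t01; have /andP[t0 t1] := t01; split=> //= [k|k|k k'].
- exact: le_trans (norm2_point k t01) c_le.
- rewrite image_point; case: ifP => _; last by rewrite norm2_0 ler01.
  rewrite norm2Z ger0_norm ?mulr_ge0//.
  have c1 : c <= 1 by move: c_le c_ge0; lra.
  by rewrite mulr_ile1// ?mulr_ge0 ?norm2_ge0// mulr_ile1.
rewrite /family => -[pE AE]; apply: val_inj => /=.
(* Equal images force t = 0; then the first point is 2 c u, while the others are non-positive
   multiples of u. *)
have apart (i j : 'I_l) : i = 0%N :> nat -> j != 0%N :> nat ->
    point t i = point t j -> A *m point t i = A *m point t j -> False.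
  move=> i0 j0 pij; rewrite !image_point i0 (negbTE j0) eqxx => /eqP.
  rewrite scaler_eq0 (negbTE Ae_neq0) orbF mulf_eq0 gt_eqF//= => /eqP t_0.
  move: pij; rewrite /point i0 (negbTE j0) eqxx t_0 subr0 scale0r addr0 scalerA.
  move/(congr1 (fun v => v + (2 * c * weight j) *: u)); rewrite scaleNr addNr.
  rewrite -scalerDl => /(congr1 (@norm2 R N)); rewrite norm2Z u1 norm2_0 mulr1.
  move=> /eqP; rewrite normr_eq0; have := weight_ge0 j.
  by move=> w0; rewrite gt_eqF// ltr_pwDl ?mulr_gt0// !mulr_ge0.
have [k0|k0] := eqVneq (k : nat) 0%N; have [k'0|k'0] := eqVneq (k' : nat) 0%N.
- by rewrite k0 k'0.
- by case: (apart k k').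
- by case: (apart k' k).
move: pE; rewrite /point (negbTE k0) (negbTE k'0) => /eqP.
rewrite -subr_eq0 -scalerBl => /eqP/(congr1 (@norm2 R N)).
rewrite norm2Z u1 norm2_0 mulr1 => /eqP; rewrite normr_eq0 subr_eq0 eqr_opp.
have c2_neq0 : 2 * c != 0 by rewrite mulf_neq0 ?pnatr_eq0// gt_eqF.
have l2_neq0 : l.-2%:R^-1 != 0 :> R by rewrite invr_eq0 gt_eqF.
rewrite (inj_eq (mulfI c2_neq0)) /weight (inj_eq (mulIf l2_neq0)) eqr_nat => /eqP.
by case: (k : nat) k0 => // i _; case: (k' : nat) k'0 => // j _ /= ->.
Qed.

(** Only the first point moves, by t c (u - e), of norm at most 2 c t <= t. *)
Lemma family_dist t k : 0 <= t ->
  norm2 ((family 0 k).1 - (family t k).1) <= t /\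
  norm2 ((family 0 k).2 - (family t k).2) <= t.
Proof.
move=> t0; rewrite /= !image_point /point; case: ifP => _; last first.
  by rewrite !subrr !norm2_0.
split.
  have -> : c *: ((2 - 0) *: u + 0 *: e) - c *: ((2 - t) *: u + t *: e) =
      (t * c) *: (u - e) by apply/matrixP => i j; rewrite !mxE; ring.
  rewrite norm2Z ger0_norm ?mulr_ge0// -mulrA ler_piMr//.
  have := ler_norm2D u (- e); rewrite norm2N u1 => ue.
  apply: le_trans c_le; rewrite mulrC ler_pM2r//; move: e1 ue; lra.
rewrite mulr0 scale0r sub0r norm2N norm2Z ger0_norm ?mulr_ge0//.
rewrite mulrC mulrA ler_piMl//.
by rewrite mulr_ile1 ?norm2_ge0//; move: c_le c_ge0; lra.
Qed.

(** The offset 2 makes the parameters at most 1/4, as used in [approximates_half_gap], and equal to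
    the distance that [corresponds_splice] allows. *)
Definition family_domain : set (training_set R N m l) :=
  [set T | T = family 0 \/ exists n, T = family (2 ^- n.+2)].

Lemma family_domain_sub : family_domain `<=` training_sets A.
Proof.
move=> _ [->|[n ->]]; apply: family_training_set; last exact: half_pow_itv.
by rewrite lexx ler01.
Qed.

(** All images lie on one ray, on which a suitable linear form is non-negative, as
    [segment_neural_network] requires. *)
Lemma union_M2_family z : union_M2 A family_domain z ->
  exists2 s, 0 <= s & z = (c * s) *: (A *m e).
Proof.
move=> [T OT [_ [k ->] <-]].
have {OT} [t t0 ->] : exists2 t, 0 <= t & T = family t.
  case: OT => [->|[n ->]]; first by exists 0.
  by exists (2 ^- n.+2); rewrite // ltW// half_pow_gt0.
rewrite image_point; case: ifP => _; first by exists t.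
by exists 0; rewrite // mulr0 scale0r.
Qed.

Let first : 'I_l := Ordinal (ltnW (ltnW l_gt2)).
Let second : 'I_l := Ordinal (ltnW l_gt2).
Let last_index_subproof : (l.-1 < l)%N.
Proof. by case: (l) l_gt2. Qed.
Let last : 'I_l := Ordinal last_index_subproof.

Lemma point_first t : point t first = c *: ((2 - t) *: u + t *: e).
Proof. by []. Qed.

Lemma point_second t : point t second = 0.
Proof. by rewrite /point /= /weight/= mul0r mulr0 oppr0 scale0r. Qed.

Let last_gt0 : (last == 0%N :> nat) = false.
Proof. by rewrite /=; case: (l) l_gt2 => [|[|]]. Qed.

Lemma point_last t : point t last = (- (2 * c)) *: u.
Proof. by rewrite /point last_gt0 /weight/= divff ?mulr1// gt_eqF. Qed.

Lemma union_M2_0 : union_M2 A family_domain 0.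
Proof.
exists (family 0); first by left.
by exists (point 0 last); [exists last|rewrite image_point last_gt0].
Qed.

Lemma union_M2_first n :
  union_M2 A family_domain ((c * 2 ^- n.+2) *: (A *m e)).
Proof.
exists (family (2 ^- n.+2)); first by right; exists n.
by exists (point (2 ^- n.+2) first); [exists first|rewrite image_point].
Qed.

Lemma zero_NN : NN act A family_domain (fun=> 0).
Proof.
split; first exact: cst_neural_network.
by exists 0 => z _; rewrite norm2_0.
Qed.

(** The first and last points 2 c u and - 2 c u are at distance 4 c in the fibre over 0, and no
    point has norm above 2 c. *)
Lemma zero_Xi : Xi act A family_domain (family 0) (fun=> 0).
Proof.
split; first exact: zero_NN.
apply: (@optimal_from_pair _ _ _ _ _ _ (point 0 first) (point 0 last) (2 * c)).
- by exists first.
- by exists last.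
- by rewrite !image_point last_gt0 eqxx mulr0 scale0r.
- rewrite point_first point_last subr0 scale0r addr0 scalerA scaleNr opprK.
  rewrite -scalerDl norm2Z u1 mulr1 ger0_norm; last by rewrite addr_ge0 ?mulr_ge0.
  by rewrite mulr2n [c * 2]mulrC.
move=> _ [k ->]; rewrite sub0r norm2N norm2_point//; by rewrite lexx ler01.
Qed.

(** The network moves on the segment from - c u, its value at 0, to c u, its value at the image of
    the moved point. Its error [c] is optimal because 0 and - 2 c u share the image 0. *)
Lemma peak_network n : exists F,
  [/\ Xi act A family_domain (family (2 ^- n.+2)) F,
      forall k, norm2 (F (A *m point (2 ^- n.+2) k) - point (2 ^- n.+2) k) <= c
    & forall z, union_M2 A family_domain z -> norm2 (F z) <= c].
Proof.
set t := 2 ^- n.+2; have /andP[_ t1] : 0 <= t <= 1 := half_pow_itv n.+2.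
have t0 : 0 < t by exact: half_pow_gt0.
have [i Aei] : exists i, (A *m e) i 0 != 0.
  apply/existsP; apply: contraNT Ae_neq0 => /existsPn Ae0.
  by apply/eqP/colP => i; rewrite [RHS]mxE; apply/eqP; rewrite -[_ == _]negbK Ae0.
(* A non-zero coordinate of [A *m e], scaled so that [g] is 1 at the image of the moved point; there
   the weight [phi] of - c u vanishes. *)
pose g : 'rV[R]_m := (c * t * (A *m e) i 0)^-1 *: delta_mx 0 i.
have gE s : (g *m ((c * s) *: (A *m e))) 0 0 = s / t.
  rewrite /g -scalemxAl -scalemxAr scalerA [LHS]mxE -rowE [X in _ * X]mxE.
  by field; rewrite Aei !gt_eqF.
have [F NF FE] := segment_neural_network hact g (- (c *: u)) (c *: u).
pose phi s := ((1 - s / t) / (1 + s / t)) ^+ 2.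
have Fz s : 0 <= s -> F ((c * s) *: (A *m e)) = (c * (1 - 2 * phi s)) *: u.
  move=> s0; rewrite FE gE ?divr_ge0 ?(ltW t0)// -/(phi s).
  by apply/matrixP => a b; rewrite !mxE; ring.
have phi01 s : 0 <= s -> 0 <= phi s <= 1.
  move=> s0; rewrite /phi sqr_ge0/= -real_normK ?num_real// exprn_ile1//.
  have st0 : 0 <= s / t by rewrite divr_ge0// ltW.
  rewrite normrM normfV (ger0_norm (_ : 0 <= 1 + s / t)) ?addr_ge0//.
  by rewrite ler_pdivrMr ?mul1r ?ltr_wpDr// ler_norml; lra.
have F0 : F 0 = - (c *: u).
  have := Fz 0 (lexx _); rewrite mulr0 scale0r => ->.
  rewrite /phi mul0r subr0 addr0 divr1 expr1n mulr1 -scaleNr; congr (_ *: _); lra.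
have Ft : F ((c * t) *: (A *m e)) = c *: u.
  rewrite Fz ?ltW// /phi divff ?gt_eqF// subrr mul0r expr0n mulr0 subr0 mulr1//.
have Fc z : union_M2 A family_domain z -> norm2 (F z) <= c.
  move=> /union_M2_family[s s0 ->]; rewrite Fz// norm2Z u1 mulr1 normrM.
  rewrite (ger0_norm c_ge0) ler_piMr// ler_norml.
  have /andP[] := phi01 _ s0; lra.
have Ferr k : norm2 (F (A *m point t k) - point t k) <= c.
  rewrite image_point /point; case: ifP => _.
    have -> : F ((c * t) *: (A *m e)) - c *: ((2 - t) *: u + t *: e) =
        (- c) *: ((1 - t) *: u + t *: e).
      by rewrite Ft; apply/matrixP => a b; rewrite !mxE; ring.
    rewrite norm2Z normrN ger0_norm// ler_piMr//.
    apply: le_trans (ler_norm2D _ _) _; rewrite !norm2Z u1 mulr1.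
    rewrite (ger0_norm (ltW t0)) ger0_norm ?subr_ge0//.
    have := ler_wpM2l (ltW t0) e1; lra.
  rewrite F0 scaleNr opprK -scaleNr -scalerDl norm2Z u1 mulr1.
  have := ler_wpM2l c_ge0 (weight_le1 k).
  have := mulr_ge0 c_ge0 (weight_ge0 k).
  rewrite ler_norml; lra.
exists F; split=> //; split; first by split=> //; exists c.
apply: (@optimal_from_pair _ _ _ _ _ _ (point t second) (point t last) c).
- by exists second.
- by exists last.
- by rewrite !image_point last_gt0.
- rewrite point_second point_last sub0r norm2N norm2Z u1 mulr1 normrN.
  by rewrite ger0_norm ?mulr_ge0// mulr2n mulrDl mul1r.
by move=> _ [k ->]; exact: Ferr.
Qed.

Lemma family_Xi_nonempty T : family_domain T -> Xi act A family_domain T !=set0.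
Proof.
move=> [->|[n ->]]; first by exists (fun=> 0); exact: zero_Xi.
by have [F [XF _ _]] := peak_network n; exists F.
Qed.

Lemma zero_approximates T : family_domain T ->
  approximates act A family_domain T c (Some (fun=> 0)).
Proof.
move=> [->|[n ->]].
  by apply: approximates_from_witness zero_Xi _ => z _; rewrite subrr norm2_0.
have [F [XF _ Fc]] := peak_network n.
by apply: approximates_from_witness XF _ => z Oz; rewrite sub0r norm2N Fc.
Qed.

(** Optimal networks are within [c] of the first and last points at their images, so [F] is within
    eps + c of them. These points are at least c (4 - 2 t) apart. *)
Lemma approximates_gap n F (eps : R) :
  approximates act A family_domain (family (2 ^- n.+2)) eps (Some F) ->
  2 * c - 2 * c * 2 ^- n.+2 - 2 * eps <=
  norm2 (F 0 - F ((c * 2 ^- n.+2) *: (A *m e))).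
Proof.
set t := 2 ^- n.+2 => Feps; have /andP[t0 t1] : 0 <= t <= 1 := half_pow_itv n.+2.
have [G [_ Gc _]] := peak_network n.
have XiG H k : Xi act A family_domain (family t) H ->
    norm2 (H (A *m point t k) - point t k) <= c.
  move=> [_ Hopt]; apply: (optimal_error_le Hopt (G := G)); last by exists k.
  by move=> _ [k' ->]; exact: Gc.
have Flast := approximates_dist_le Feps union_M2_0
  (fun H XH => ltac:(have := XiG H last XH; rewrite image_point last_gt0; exact)).
have Ffirst := approximates_dist_le Feps (union_M2_first n)
  (fun H XH => ltac:(have := XiG H first XH; rewrite image_point; exact)).
rewrite -/t point_last in Flast; rewrite -/t point_first in Ffirst.
have : c * (4 - 2 * t) <= norm2 (c *: ((2 - t) *: u + t *: e) - (- (2 * c)) *: u).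
  have -> : c *: ((2 - t) *: u + t *: e) - (- (2 * c)) *: u =
      c *: ((4 - t) *: u - (- t) *: e) by apply/matrixP => i j; rewrite !mxE; ring.
  rewrite norm2Z ger0_norm// ler_pM2l//.
  have := ler_norm2B ((4 - t) *: u) ((- t) *: e) 0.
  rewrite !subr0 !norm2Z u1 mulr1 normrN (ger0_norm t0) ger0_norm; last lra.
  have := ler_wpM2l t0 e1; lra.
have := ler_norm2B (c *: ((2 - t) *: u + t *: e)) (F ((c * t) *: (A *m e)))
  ((- (2 * c)) *: u).
have := ler_norm2B (F ((c * t) *: (A *m e))) (F 0) ((- (2 * c)) *: u).
rewrite (norm2B (F 0) (F _)) (norm2B _ (F ((c * t) *: _))); lra.
Qed.

(** * Algorithms on inputs of the family *)

Local Notation Omega := family_domain.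
Local Notation vertex n := ((c * 2 ^- n.+2) *: (A *m e)).

(** Here [f.1.2] is the index in the sequence of approximations; finitely many read-outs cannot
    separate such an input from inputs of all nearby training sets. *)
Definition limit_input (iota0 : input Omega) : Prop :=
  corresponds (sval iota0) (family 0) /\
  forall n, exists iota : input Omega,
    corresponds (sval iota) (family (2 ^- n.+2)) /\
    forall f : readout N m l, (f.1.2 <= n)%N ->
      read f (sval iota) = read f (sval iota0).

Lemma exists_limit_input : exists iota0, limit_input iota0.
Proof.
have [iota0 fine0] := exists_finely_corresponds (family 0).
have corr0 := finely_corresponds_weaken fine0.
have O0 : Omega (family 0) by left.
exists (exist _ iota0 (ex_intro2 _ _ _ O0 corr0)); split=> // n.
have [iota [corr iotaE]] := corresponds_splice fine0
  (fun k => family_dist k (ltW (half_pow_gt0 n.+2))).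
have On : Omega (family (2 ^- n.+2)) by right; exists n.
exists (exist _ iota (ex_intro2 _ _ _ On corr)); split=> // -[[k j] [i|i]] /= jn;
  by rewrite iotaE.
Qed.

Lemma vertex_cvg (F : 'cV[R]_m -> 'cV[R]_N) : NN act A Omega F ->
  norm2 (F 0 - F (vertex n)) @[n --> \oo] --> (0 : R).
Proof.
move=> [netF _]; exact: neural_network_gap hact netF (half_pow_cvg c).
Qed.

Lemma approximates_half_gap n F :
  approximates act A Omega (family (2 ^- n.+2)) (c / 2) (Some F) ->
  c / 2 <= norm2 (F 0 - F (vertex n)).
Proof.
move=> /approximates_gap; apply: le_trans.
have : 2 ^- n.+2 <= 2^-1 ^+ 2 :> R by rewrite exprVn half_pow_le.
move: c_gt0; rewrite expr2; nra.
Qed.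

(** The output on [iota0] depends on terms up to some index [q], shared with inputs of the training
    sets with n >= q, so the same [F] must serve all of these. *)
Lemma algorithm_gap (Gamma : general_algorithm act A Omega) (eps : R) iota0 :
  limit_input iota0 ->
  (forall T, Omega T -> forall iota : input Omega, corresponds (sval iota) T ->
     approximates act A Omega T eps (ga_out Gamma iota)) ->
  exists2 F, ga_out Gamma iota0 = Some F &
    exists q, forall n, (q <= n)%N ->
      approximates act A Omega (family (2 ^- n.+2)) eps (Some F).
Proof.
move=> [corr0 near0] Gamma_eps.
have := Gamma_eps (family 0) (or_introl erefl) iota0 corr0.
case outE: (ga_out Gamma iota0) => [F|]; last by rewrite /approximates/= leNgt ltry.
move=> _; exists F => //.
have fin : finite_set (ga_reads Gamma iota0) by apply: ga_finite; rewrite outE.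
have [q qP] := finite_readouts_bounded fin.
exists q => n qn; have [iota [corr iotaE]] := near0 n.
have <- : ga_out Gamma iota = Some F.
  by rewrite -outE; apply: ga_determined => f /qP fq; rewrite iotaE// (leq_trans fq).
by apply: Gamma_eps corr; right; exists n.
Qed.

Lemma no_algorithm : ~ exists Gamma : general_algorithm act A Omega,
  forall T, Omega T -> forall iota : input Omega, corresponds (sval iota) T ->
    approximates act A Omega T (c / 2) (ga_out Gamma iota).
Proof.
move=> [Gamma Gamma_eps]; have [iota0 lim0] := exists_limit_input.
have [F outE [q qP]] := algorithm_gap lim0 Gamma_eps.
have /vertex_cvg/cvgrPdist_lt/(_ (c / 2)) := ga_range outE.
case; first by rewrite divr_gt0.
move=> n0 _ /(_ (maxn q n0)) /=; rewrite leq_maxr => /(_ isT).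
rewrite sub0r normrN ger0_norm ?norm2_ge0// ltNge approximates_half_gap//.
by apply: qP; rewrite leq_maxl.
Qed.

Lemma no_randomised_algorithm (p : R) (enum : nat -> readout N m l) :
  1 / 2 < p -> bijective enum ->
  ~ exists (d : measure_display) (X : measurableType d)
       (alg : X -> general_algorithm act A Omega)
       (P : input Omega -> probability X R),
     randomised_general_algorithm enum alg P /\
     forall T, Omega T -> forall iota : input Omega, corresponds (sval iota) T ->
       (p%:E < P iota [set g | approximates act A Omega T (c / 2)
                                 (ga_out (alg g) iota)])%E.
Proof.
move=> p12 [denum denumK enumK] [d [X [alg [P [rga success]]]]].
have [iota0 [corr0 near0]] := exists_limit_input.
have [iota iotaP] := choice near0.
pose good T i := [set g | approximates act A Omega T (c / 2) (ga_out (alg g) i)].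
have good_measurable T i : measurable (good T i).
  pose B := [set F | NN act A Omega F /\
                     approximates act A Omega T (c / 2) (Some F)].
  have -> : good T i = [set g | (Some @` B) (ga_out (alg g) i)].
    apply/seteqP; split=> g /=; last by move=> [F [_ appF] outE]; rewrite /good/= -outE.
    rewrite /good/=; case outE: (ga_out (alg g) i) => [F|] app.
      by exists F => //; split=> //; exact: ga_range outE.
    by move: app; rewrite /approximates/= leNgt ltry.
  by apply: rga_measurable rga _ _ _; exists B; [exact: approximates_borel|left].
pose bounded k := [set g | forall r, ga_reads (alg g) iota0 (enum r) -> (r <= k)%N].
have bounded_measurable k : measurable (bounded k).
  exact: rga_reads_measurable rga _ _.
(* A good output is not a failure to halt, so it comes from finitely many reads; continuity from
   below then gives one [k] with probability above [p]. *)
have good_bounded : good (family 0) iota0 `<=` \bigcup_k bounded k.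
  move=> g; rewrite /good/= => app.
  have fin : finite_set (ga_reads (alg g) iota0).
    apply: ga_finite => out0; move: app.
    by rewrite out0 /approximates/= leNgt ltry.
  have /finite_seqP[s sE] : finite_set (enum @^-1` ga_reads (alg g) iota0).
    by apply: finite_preimage fin => x y _ _; exact: (can_inj denumK).
  exists (\max_(r <- s) r)%N => // r rs.
  have {}rs : (enum @^-1` ga_reads (alg g) iota0) r by [].
  by rewrite sE in rs; exact: leq_bigmax_seq.
have [k pk] : exists k, (p%:E < P iota0 (bounded k))%E.
  apply: contrapT => /forallNP bounded_le.
  have := success (family 0) (or_introl erefl) iota0 corr0.
  apply/negP; rewrite -leNgt.
  have bigcup_measurable : measurable (\bigcup_k bounded k).
    exact: bigcup_measurable.
  apply: (@le_trans _ _ (P iota0 (\bigcup_k bounded k))).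
    by apply: le_measure; rewrite ?inE//; exact: good_measurable.
  have cvgP : (P iota0 \o bounded) n @[n --> \oo] --> P iota0 (\bigcup_k bounded k).
    apply: nondecreasing_cvg_mu => // i j ij; apply/subsetPset => g gi r rg.
    exact: leq_trans (gi r rg) ij.
  rewrite -(cvg_lim _ cvgP)//; apply: lime_le; first by apply/cvg_ex; eexists; exact: cvgP.
  by apply: nearW => n /=; rewrite leNgt; apply/negP.
(* Algorithms in [bounded k] use only the first k + 1 read-outs on [iota0], whose sequence indices
   are at most [q]; for n >= q they cannot tell [iota n] from [iota0]. *)
pose q := (\max_(r < k.+1) (enum r).1.2)%N.
have iota_bounded n g : (q <= n)%N -> bounded k g ->
    forall f, ga_reads (alg g) iota0 f -> read f (sval (iota n)) = read f (sval iota0).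
  move=> qn gk f gf; apply: (iotaP n).2; apply: leq_trans qn.
  have fk : (denum f < k.+1)%N by rewrite ltnS; apply: gk; rewrite enumK.
  rewrite -[f in (f.1.2 <= _)%N]enumK.
  exact: (@leq_bigmax 'I_k.+1 (fun r => (enum r).1.2) (Ordinal fk)).
have P_bounded n E : (q <= n)%N -> measurable E -> E `<=` bounded k ->
    P iota0 E = P (iota n) E.
  move=> qn mE Ek; apply: (rga_consistent rga) => // g f /Ek gk gf.
  by rewrite (iota_bounded n g).
(* Inside [bounded k] the probabilities for [iota (n + q)] and [iota0] agree, so these events have
   probability at least 2 p - 1 > 0 under the single measure [P iota0]. *)
pose trapped n := good (family (2 ^- (n + q).+2)) (iota (n + q)) `&` bounded k.
have trapped_measurable n : measurable (trapped n) by exact: measurableI.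
have trapped_ge n : ((2 * p - 1)%:E <= P iota0 (trapped n))%E.
  have qn := leq_addl n q; have [corr _] := iotaP (n + q)%N.
  have On : Omega (family (2 ^- (n + q).+2)) by right; exists (n + q)%N.
  rewrite (P_bounded (n + q)%N)//; last exact: subIsetr.
  apply: probability_setI_ge; [exact: good_measurable|exact: bounded_measurable| |].
    exact: success _ On _ corr.
  by rewrite -(P_bounded (n + q)%N).
(* One algorithm [g] is trapped infinitely often, and on all these inputs it returns its output for
   [iota0], contradicting the continuity of that network at 0. *)
have [g glim] : lim_sup_set trapped !=set0.
  by apply: lim_sup_set_nonempty trapped_ge => //; move: p12; lra.
have often n : exists2 j, (n <= j)%N & trapped j g.
  by have [j /= nj gj] := glim n I; exists j.
have [j0 _ [app gk]] := often 0%N.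
have out j : ga_out (alg g) (iota (j + q)) = ga_out (alg g) iota0.
  by apply: ga_determined => f; apply: iota_bounded => //; exact: leq_addl.
move: app; rewrite /good/= out.
case outE: (ga_out (alg g) iota0) => [F|]; last by rewrite /approximates/= leNgt ltry.
move=> _; have /vertex_cvg/cvgrPdist_lt/(_ (c / 2)) := ga_range outE.
case; first by rewrite divr_gt0.
move=> n0 _; have [j n0j [app _]] := often n0.
move=> /(_ (j + q)%N) /=; rewrite (leq_trans n0j (leq_addr _ _)) => /(_ isT).
rewrite sub0r normrN ger0_norm ?norm2_ge0// ltNge approximates_half_gap//.
by move: app; rewrite /good/= out outE.
Qed.

Lemma steep_output (Gamma : general_algorithm act A Omega) iota0 (K0 delta eps : R) :
  limit_input iota0 -> 0 < K0 -> 0 < delta -> eps <= c - delta ->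
  (forall T, Omega T -> forall iota : input Omega, corresponds (sval iota) T ->
     approximates act A Omega T eps (ga_out Gamma iota)) ->
  exists2 F, ga_out Gamma iota0 = Some F &
    forall eta : R, 0 < eta -> exists y : 'cV[R]_m,
      [/\ y != 0, norm2 y <= eta & K0 < norm2 (F 0 - F y) / norm2 y].
Proof.
move=> lim0 K0_gt0 delta_gt0 eps_le Gamma_eps.
have [F outE [q qP]] := algorithm_gap lim0 Gamma_eps.
exists F => // eta eta_gt0.
(* For t = 2^-(n+2) the gap is at least 2 delta - t, above [delta] once t < delta, while [K0] times
   the norm of the vertex is at most K0 t < delta. *)
have min_gt0 : 0 < Num.min eta (Num.min delta (delta / K0)).
  by rewrite !lt_min eta_gt0 delta_gt0 divr_gt0.
have [n0 n0P] := exists_half_pow min_gt0.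
pose n := maxn q n0.
have : 2 ^- n.+2 < Num.min eta (Num.min delta (delta / K0)).
  apply: le_lt_trans n0P; apply: half_pow_le.
  by rewrite (leq_trans (leq_maxr q n0))// -addn2 leq_addr.
rewrite !lt_min => /and3P[n_eta n_delta n_slope].
have gap := approximates_gap (qP n (leq_maxl _ _)).
have t0 : 0 < 2 ^- n.+2 :> R by exact: half_pow_gt0.
have y_neq0 : vertex n != 0.
  by rewrite scaler_eq0 negb_or Ae_neq0 mulf_neq0 ?gt_eqF.
have y_le : norm2 (vertex n) <= 2 ^- n.+2.
  rewrite norm2Z ger0_norm ?mulr_ge0 ?(ltW t0)// mulrC mulrA ler_piMl ?(ltW t0)//.
  rewrite mulr_ile1 ?norm2_ge0//; move: c_le c_ge0; lra.
exists (vertex n); split=> //; first exact: le_trans y_le (ltW n_eta).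
rewrite ltr_pdivlMr ?norm2_gt0//; apply: le_lt_trans (ler_wpM2l (ltW K0_gt0) y_le) _.
have : K0 * 2 ^- n.+2 < delta by rewrite mulrC -ltr_pdivlMr.
have : 2 * c * 2 ^- n.+2 <= 2 ^- n.+2 by rewrite ler_piMl// ltW.
move: gap eps_le n_delta; lra.
Qed.

End TrainingFamily.

(** * Vectors adapted to the linear map *)

Section Geometry.
Context {R : realType} {N m : nat} (A : 'M[R]_(m, N)).

(** The columns of [cokermx A] are annihilated by A, and one of them is non-zero because the rank of
    A is at most m < N. *)
Lemma exists_unit_kernel : (m < N)%N -> exists u, A *m u = 0 /\ norm2 u = 1.
Proof.
move=> mN; have /eqP/matrix0Pn[i [j Kij]] : cokermx A <> 0.
  move=> /(congr1 (@mxrank _ _ _)); rewrite mxrank_coker mxrank0 => /eqP.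
  by rewrite subn_eq0 leqNgt (leq_ltn_trans (rank_leq_row A) mN).
pose v := col j (cokermx A).
have Av : A *m v = 0 by rewrite /v colE mulmxA mulmx_coker mul0mx.
have v0 : 0 < norm2 v.
  apply: norm2_gt0; apply: contra_neq Kij => v0.
  by have := congr1 (fun w : 'cV_N => w i 0) v0; rewrite !mxE.
exists ((norm2 v)^-1 *: v); rewrite -scalemxAr Av scaler0; split=> //.
by rewrite norm2Z gtr0_norm ?invr_gt0// mulVf// gt_eqF.
Qed.

Lemma exists_small_image : A != 0 ->
  exists e, [/\ norm2 e <= 1, A *m e != 0 & norm2 (A *m e) <= 1].
Proof.
move=> /matrix0Pn[i [j Aij]]; pose d : 'cV[R]_N := delta_mx j 0.
have Ad : A *m d != 0.
  apply: contra_neq Aij => Ad0.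
  by have := congr1 (fun w : 'cV_m => w i 0) Ad0; rewrite -colE !mxE.
pose a := 1 + norm2 d + norm2 (A *m d).
have a0 : 0 < a by rewrite !ltr_wpDr ?norm2_ge0.
have scaled p (v : 'cV[R]_p) : norm2 v <= a -> norm2 (a^-1 *: v) <= 1.
  by move=> va; rewrite norm2Z gtr0_norm ?invr_gt0// mulrC ler_pdivrMr// mul1r.
exists (a^-1 *: d); rewrite -scalemxAr; split.
- apply: scaled; rewrite /a; have := norm2_ge0 (A *m d); lra.
- by rewrite scaler_eq0 negb_or invr_eq0 gt_eqF.
- apply: scaled; rewrite /a; have := norm2_ge0 d; lra.
Qed.

End Geometry.

(** * The zero network as output, and the choice of the constants *)

Lemma lipschitz_constant_cst (R : realType) (N m : nat) (b : 'cV[R]_N) (D : R) :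
  0 <= D -> (lipschitz_constant (fun _ : 'cV[R]_m => b) <= D%:E)%E.
Proof.
move=> D0; apply: ge_ereal_sup => _ [y [y' [_ ->]]].
by rewrite subrr norm2_0 mul0r lee_fin.
Qed.

Lemma zero_network_code (R : realType) (K N m : nat) (act : 'I_K -> R -> R) :
  exists w, blank \notin w /\ encodes_network act w (fun _ : 'cV[R]_m => 0 : 'cV[R]_N).
Proof.
pose net : network coef K N m :=
  OutputLayer K (const_mx (RatCoef 0)) (const_mx (RatCoef 0)).
exists (write_nats (ser_network net)); split; first exact: write_nats_nonblank.
exists net, (fun=> 0); split=> //.
  by split=> [i j|i]; rewrite mxE /= rmorph0.
apply: funext => y /=; apply/colP => i.
by rewrite !mxE big1 ?addr0// => j _; rewrite !mxE mul0r.
Qed.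

Theorem theorem3p1 (R : realType) (nact : nat) (act : 'I_nact -> R -> R)
    (hact : admissible_activations act)
    (N m : nat) (hm : (1 <= m)%N) (hN : (m < N)%N)
    (beta : R) (hbeta : 0 < beta)
    (A : 'M[R]_(m, N)) (hA : A != 0)
    (hspec : forall a : R, eigenvalue (A *m A^T) a -> beta ^+ 2 <= a)
    (eps1 : rat) (heps1 : 0 < eps1 <= 3 / 16)
    (l : nat) (hl : (m + 2 < l)%N) :
  exists Omega : set (training_set R N m l),
    Omega `<=` training_sets A /\
    (forall T, Omega T -> Xi act A Omega T !=set0) /\
    (* (i) *)
    ((~ exists Gamma : general_algorithm act A Omega,
         forall T, Omega T ->
         forall iota : input Omega, corresponds (sval iota) T ->
           approximates act A Omega T (ratr eps1) (ga_out Gamma iota)) /\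
     (forall p : R, 1 / 2 < p ->
      forall e : nat -> readout N m l, bijective e ->
      ~ exists (d : measure_display) (X : measurableType d)
           (alg : X -> general_algorithm act A Omega)
           (P : input Omega -> probability X R),
         randomised_general_algorithm e alg P /\
         forall T, Omega T ->
         forall iota : input Omega, corresponds (sval iota) T ->
           (p%:E < P iota [set g | approximates act A Omega T (ratr eps1)
                                     (ga_out (alg g) iota)])%E)) /\
    (* (ii) *)
    (exists M : machine,
       forall T, Omega T ->
       forall iota : input Omega, corresponds (sval iota) T ->
       forall eps : rat, is_dyadic eps -> 2 * eps1 < eps ->
       exists (w : word) (F : 'cV[R]_m -> 'cV[R]_N),
         [/\ halts_with (input_oracle (sval iota)) M (rat_word eps) w,
             encodes_network act w F,
             NN act A Omega F,
             approximates act A Omega T (ratr eps) (Some F)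
           & (lipschitz_constant F <= (2 / beta)%:E)%E]) /\
    (* (iii) *)
    (exists (T1 : training_set R N m l) (D : R),
       [/\ Omega T1, 0 < D, Xi_lip act A Omega D T1 !=set0
         & exists iota1 : input Omega, corresponds (sval iota1) T1 /\
           forall (K delta eps : R) (Gamma : R -> general_algorithm act A Omega),
             0 < K -> 0 < delta < ratr eps1 ->
             ratr eps1 < eps <= 2 * ratr eps1 - delta ->
             (forall T, Omega T ->
              forall iota : input Omega, corresponds (sval iota) T ->
                approximates act A Omega T eps (ga_out (Gamma eps) iota)) ->
           exists F : 'cV[R]_m -> 'cV[R]_N,
             [/\ ga_out (Gamma eps) iota1 = Some F,
                 pi2 T1 0
               & forall eta : R, 0 < eta ->
                 exists y : 'cV[R]_m,
                   [/\ y != 0, norm2 y <= eta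
                     & K < norm2 (F 0 - F y) / norm2 y]]]).
Proof.
have [u [Au0 u1]] := exists_unit_kernel A hN.
have [e [e1 Ae_neq0 Ae1]] := exists_small_image hA.
have eps1_gt0 : 0 < ratr eps1 :> R by rewrite ltr0q; case/andP: heps1.
(* Accuracy c / 2 is the barrier in (i), [c] is the error of the zero network in (ii), and c - delta
   bounds the accuracy in (iii). The bound 3/16 gives 2 c <= 3/4. *)
pose c : R := 2 * ratr eps1.
have c_gt0 : 0 < c by rewrite mulr_gt0.
have c_half : c / 2 = ratr eps1 by rewrite mulrC mulKf// pnatr_eq0.
have c_le : 2 * c <= 1.
  have : ratr eps1 <= ratr (3 / 16) :> R by rewrite ler_rat; case/andP: heps1.
  rewrite fmorph_div !rmorph_nat /c; lra.
have l_gt2 : (2 < l)%N by rewrite (leq_ltn_trans _ hl)// leq_addl.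
pose Omega : set (training_set R N m l) := family_domain A u e c.
have zeroXi : Xi act A Omega (family A u e c 0) (fun=> 0) by exact: zero_Xi.
exists Omega; split; first exact: family_domain_sub.
split; first by move=> T OT; exact: family_Xi_nonempty OT.
split.
  rewrite -c_half; split; first exact: no_algorithm.
  by move=> p p12 enum enum_bij; exact: no_randomised_algorithm.
split.
  have [w [w_nonblank w_code]] := zero_network_code N m act.
  exists (writer separator w) => T OT iota _ eps _ eps_gt.
  have eps_gt0 : 0 <= eps.
    by case/andP: heps1 => e0 _; rewrite (le_trans _ (ltW eps_gt))// mulr_ge0 ?ltW.
  exists w, (fun=> 0); split=> //.
  - exact: writer_halts (rat_word_head eps_gt0) w_nonblank.
  - exact: zero_NN.
  - apply: (@le_trans _ _ c%:E); first exact: zero_approximates.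
    by rewrite lee_fin /c -(rmorph_nat (@ratr R)) -rmorphM ler_rat ltW.
  - by apply: lipschitz_constant_cst; rewrite divr_ge0 ?ltW.
have [iota0 lim0] := exists_limit_input (l := l) Au0 u1 e1 Ae1 c_gt0 c_le.
exists (family A u e c 0), 1; split; first by left.
- exact: ltr01.
- by exists (fun=> 0); split=> //; exact: lipschitz_constant_cst.
exists iota0; split; first by case: lim0.
move=> K delta eps Gamma K_gt0 /andP[delta_gt0 _] /andP[_ eps_le] Gamma_eps.
have [F outE steep] := steep_output hact l_gt2 Au0 u1 e1 Ae_neq0 Ae1 c_gt0 c_le
  lim0 K_gt0 delta_gt0 eps_le Gamma_eps.
exists F; split=> //; exists (Ordinal (ltnW (ltnW l_gt2))).
by rewrite /= image_point// mulr0 scale0r.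
Qed.
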